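(* Let $0<\alpha_1,\alpha_2\leq 1$ and $\theta=\frac{\alpha_2-\alpha_1}{\alpha_2+\alpha_1}$. If $f\in\mathcal{S}^*_t(\alpha_1,\alpha_2)$, then $$\mathrm{Re}\left\{\frac{zf'(z)}{f(z)}\right\}\geq\left(\frac{1-(2\cos\frac{\theta}{2}+1)r}{1-r}\right)^{(\alpha_1+\alpha_2)/2}\quad\text{for } 0\leq |z|=r\leq\frac{1}{2\cos\frac{\theta}{2}+1},$$ and $$0<\mathrm{Re}\left\{\frac{zf'(z)}{f(z)}\right\}\leq\left(\frac{1+(2\cos\frac{\theta}{2}-1)r}{1-r}\right)^{(\alpha_1+\alpha_2)/2}\quad\text{for } 0\leq |z|=r<1.$$
   Context: $\Delta=\{z\in\mathbb{C}:|z|<1\}$. $\mathcal{S}^*_t(\alpha_1,\alpha_2)$ denotes the class of functions $f$ analytic in $\Delta$ with $f(0)=0=f'(0)-1$ satisfying $-\frac{\pi\alpha_1}{2}<\arg\left\{\frac{zf'(z)}{f(z)}\right\}<\frac{\pi\alpha_2}{2}$ for all $z\in\Delta$. *)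

(* Defs.v *)
From Stdlib Require Import Reals.
From Coquelicot Require Export Coquelicot.
Open Scope R_scope.

Definition has_cderiv (f : C -> C) (z l : C) : Prop :=
  is_derive (K := C_AbsRing) (V := C_NormedModule) f z l.

Definition analytic_disk_with (f f' : C -> C) : Prop :=
  forall z : C, Cmod z < 1 -> has_cderiv f z (f' z).

Definition is_arg (w : C) (t : R) : Prop :=
  w <> 0%C /\ -PI < t <= PI /\ w = (RtoC (Cmod w) * (cos t, sin t))%C.

Definition arg_between (w : C) (lo hi : R) : Prop :=
  exists t, is_arg w t /\ lo < t < hi.

(* The class S*_t(a1,a2); f' is the (complex) derivative of f on Delta.
   At z = 0 the quotient z f'(z)/f(z) is the removable value 1, which
   lies in the sector; the condition is imposed for z <> 0. *)
Definition Sstar_t (a1 a2 : R) (f f' : C -> C) : Prop :=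
  analytic_disk_with f f' /\ f 0%C = 0%C /\ f' 0%C = 1%C /\
  forall z : C, Cmod z < 1 -> z <> 0%C ->
    arg_between (z * f' z / f z)%C (- PI * a1 / 2) (PI * a2 / 2).

(* Real power x^y for x >= 0 with the convention 0^y = 0 (y > 0). *)
Definition rpow (x y : R) : R :=
  if Req_EM_T x 0 then 0 else Rpower x y.

(* Main.v *)
(** The quotient [q(z) = z f'(z) / f(z)] takes its values in a sector and [q(0) = 1], so with
    [b = (a1 + a2) / 2] the function [q^(1/b)] maps the disk into a half-plane, and the Schwarz
    lemma for a Moebius image of it gives [|q^(1/b) - 1| <= |z| |q^(1/b) + e^(i pi theta)|].
    Hence [|q^(1/b) - 1| <= 2 cos(pi theta / 2) r / (1 - r)], with [cos(pi theta / 2) <= c]; both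
    bounds follow, the lower one using [cos(b s) >= (cos s)^b].

    Since [f'] is not known to be differentiable, or even continuous, the Schwarz lemma is applied
    not to [q] but to [Q_d(z) = log(f(z e^(id)) / f(z)) / (i d)]. This is holomorphic for [z <> 0],
    lies in the sector by the mean value theorem along arcs (the sector is an intersection of
    half-planes), tends to [1] at [0], and converges to [q(z)] as [d -> 0]. The Schwarz lemma
    follows from Goursat's bisection argument in the coordinate [log z] and a Poisson kernel. *)

Require Import Defs.
From Stdlib Require Import Reals Lra Lia.
From Coquelicot Require Import Coquelicot.
Open Scope R_scope.

(** * Continuity and complex differentiability *)

(** In the half-plane picture [-e^(i pi theta)] is the mirror image of [1] in the boundary line;
    this is why it appears in the Moebius map. The constant of the theorem comes from [Cmod (1 +
    e^(i pi theta)) = 2 cos (pi theta / 2)], used in the triangle inequality for [g + e^(i pi theta)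
    = (g - 1) + (1 + e^(i pi theta))].

    The logarithm in [Q_d] requires [f (z e^(id)) / f z] to stay in the right half-plane for one [d]
    and all [z] at once. Compactness gives this only on disks of radius [rho < 1], so the Schwarz
    lemma yields a factor [Cmod z / rho], and the limit [d -> 0] is taken before [rho -> 1]. At
    [z = 0] the ratio is read through [f z / z], of which only continuity is established there. The
    Schwarz lemma therefore has to tolerate a point of mere continuity, and it is derived from means
    over circles, which pass such a point by continuity in the radius. *)

Lemma continuous_pair_C {T : UniformSpace} (F : T -> C) (x : T) :
  continuous (fun t => Re (F t)) x -> continuous (fun t => Im (F t)) x ->
  continuous F x.
Proof.
intros H1 H2. apply filterlim_locally. intros eps.
generalize (proj1 (filterlim_locally _ _) H1 eps) (proj1 (filterlim_locally _ _) H2 eps).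
intros A B; generalize (filter_and _ _ A B); apply filter_imp; intros t [P Q]; split; assumption.
Qed.

Lemma continuous_Re {T : UniformSpace} (F : T -> C) (x : T) :
  continuous F x -> continuous (fun t => Re (F t)) x.
Proof.
intros H. apply (continuous_comp F fst); [exact H|].
destruct (F x). apply continuous_fst.
Qed.

Lemma continuous_Im {T : UniformSpace} (F : T -> C) (x : T) :
  continuous F x -> continuous (fun t => Im (F t)) x.
Proof.
intros H. apply (continuous_comp F snd); [exact H|].
destruct (F x). apply continuous_snd.
Qed.

Lemma continuous_Cplus {T : UniformSpace} (F G : T -> C) (x : T) :
  continuous F x -> continuous G x -> continuous (fun t => (F t + G t)%C) x.
Proof.
intros HF HG; apply continuous_pair_C; simpl.
- apply (continuous_plus (V := R_NormedModule)); now apply continuous_Re.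
- apply (continuous_plus (V := R_NormedModule)); now apply continuous_Im.
Qed.

Lemma continuous_Copp {T : UniformSpace} (F : T -> C) (x : T) :
  continuous F x -> continuous (fun t => (- F t)%C) x.
Proof.
intros HF; apply continuous_pair_C; simpl.
- apply (continuous_opp (V := R_NormedModule)); now apply continuous_Re.
- apply (continuous_opp (V := R_NormedModule)); now apply continuous_Im.
Qed.

Lemma continuous_Cminus {T : UniformSpace} (F G : T -> C) (x : T) :
  continuous F x -> continuous G x -> continuous (fun t => (F t - G t)%C) x.
Proof. intros HF HG; apply continuous_Cplus; [exact HF|]. now apply continuous_Copp. Qed.

Lemma continuous_Rmult {T : UniformSpace} (F G : T -> R) (x : T) :
  continuous F x -> continuous G x -> continuous (fun t => F t * G t) x.
Proof. apply (continuous_mult (K := R_AbsRing)). Qed.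

Lemma continuous_Rplus {T : UniformSpace} (F G : T -> R) (x : T) :
  continuous F x -> continuous G x -> continuous (fun t => F t + G t) x.
Proof. apply (continuous_plus (V := R_NormedModule)). Qed.

Lemma continuous_Rminus {T : UniformSpace} (F G : T -> R) (x : T) :
  continuous F x -> continuous G x -> continuous (fun t => F t - G t) x.
Proof. apply (continuous_minus (V := R_NormedModule)). Qed.

Lemma continuous_Cmult {T : UniformSpace} (F G : T -> C) (x : T) :
  continuous F x -> continuous G x -> continuous (fun t => (F t * G t)%C) x.
Proof.
intros HF HG.
assert (A := continuous_Re _ _ HF). assert (B := continuous_Im _ _ HF).
assert (D := continuous_Re _ _ HG). assert (E := continuous_Im _ _ HG).
apply continuous_pair_C; simpl.
- apply continuous_Rminus; now apply continuous_Rmult.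
- apply continuous_Rplus; now apply continuous_Rmult.
Qed.

Lemma continuous_C_comp_R {T : UniformSpace} (F : T -> R) (g : R -> R) (x : T) :
  continuous F x -> continuity_pt g (F x) -> continuous (fun t => g (F t)) x.
Proof.
intros HF Hg. apply (continuous_comp F g); [exact HF|].
now apply continuity_pt_filterlim.
Qed.

Lemma continuous_sqr_sum {T : UniformSpace} (F G : T -> R) (x : T) :
  continuous F x -> continuous G x -> continuous (fun t => F t ^ 2 + G t ^ 2) x.
Proof.
intros HF HG.
assert (Hs : forall u, continuity_pt (fun y => y ^ 2) u)
  by (intros u; apply derivable_continuous_pt, derivable_pt_pow).
apply continuous_Rplus.
- exact (continuous_C_comp_R F (fun y => y ^ 2) x HF (Hs _)).
- exact (continuous_C_comp_R G (fun y => y ^ 2) x HG (Hs _)).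
Qed.

Lemma C_sqr_sum_neq_0 (z : C) : z <> 0%C -> fst z ^ 2 + snd z ^ 2 <> 0.
Proof.
intros H E. apply H. destruct z as [x y]; simpl in *.
assert (x = 0) by nra. assert (y = 0) by nra. now subst.
Qed.

Lemma continuous_Cinv {T : UniformSpace} (F : T -> C) (x : T) :
  continuous F x -> F x <> 0%C -> continuous (fun t => (/ F t)%C) x.
Proof.
intros HF Hn.
assert (A := continuous_Re _ _ HF). assert (B := continuous_Im _ _ HF).
assert (D : continuous (fun t => / (Re (F t) ^ 2 + Im (F t) ^ 2)) x).
{ apply (continuous_C_comp_R (fun t => Re (F t) ^ 2 + Im (F t) ^ 2) Rinv).
  - exact (continuous_sqr_sum _ _ _ A B).
  - apply continuity_pt_inv; [apply derivable_continuous_pt, derivable_pt_id|].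
    now apply C_sqr_sum_neq_0. }
apply continuous_pair_C; simpl; apply continuous_Rmult; trivial.
apply (continuous_opp (V := R_NormedModule)); trivial.
Qed.

Lemma continuous_Cdiv {T : UniformSpace} (F G : T -> C) (x : T) :
  continuous F x -> continuous G x -> G x <> 0%C ->
  continuous (fun t => (F t / G t)%C) x.
Proof. intros HF HG Hn; apply continuous_Cmult; [exact HF|]. now apply continuous_Cinv. Qed.

Lemma continuous_Cmod {T : UniformSpace} (F : T -> C) (x : T) :
  continuous F x -> continuous (fun t => Cmod (F t)) x.
Proof.
intros HF. unfold Cmod.
apply (continuous_C_comp_R (fun t => Re (F t) ^ 2 + Im (F t) ^ 2) sqrt).
- apply (continuous_sqr_sum (fun t => Re (F t)) (fun t => Im (F t)));
    [now apply continuous_Re|now apply continuous_Im].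
- apply continuity_pt_sqrt. apply Rplus_le_le_0_compat; apply pow2_ge_0.
Qed.

(** The balls of the uniform structure on [C] are squares, since it is a product; squares and disks
    are comparable up to the factor [sqrt 2]. *)
Lemma locally_C_Cmod (z : C) (P : C -> Prop) :
  locally z P <-> exists d, 0 < d /\ forall w, Cmod (w - z) < d -> P w.
Proof.
split.
- intros [d Hd]. exists d; split; [apply cond_pos|]. intros w Hw. apply Hd.
  now apply C_NormedModule_mixin_compat1.
- intros [d [Hd H]].
  assert (Hs : 0 < sqrt 2) by (apply sqrt_lt_R0; lra).
  assert (Hp : 0 < d / sqrt 2) by now apply Rdiv_lt_0_compat.
  exists (mkposreal _ Hp). intros w Hw. apply H.
  eapply Rlt_le_trans; [apply (C_NormedModule_mixin_compat2 _ _ _ Hw)|].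
  simpl. right; field. lra.
Qed.

Lemma continuous_C_Cmod {T : UniformSpace} (F : T -> C) (x : T) :
  continuous F x <->
  forall eps, 0 < eps -> locally x (fun t => Cmod (F t - F x) < eps).
Proof.
split.
- intros H eps He. apply (H (fun w => Cmod (w - F x) < eps)).
  apply locally_C_Cmod. exists eps; split; auto.
- intros H P HP. apply locally_C_Cmod in HP. destruct HP as [d [Hd HP]].
  change (locally x (fun t => P (F t))).
  generalize (H d Hd). apply filter_imp. intros t Ht. now apply HP.
Qed.

(* [ring] and [field] do not recognise the carrier of [C_UniformSpace] as [C]. *)
Ltac cring :=
  cbv beta; change (UniformSpace.sort C_UniformSpace) with C in *;
  match goal with |- @eq _ ?a ?b => change (@eq C a b); ring end.
Ltac cfield :=
  cbv beta; change (UniformSpace.sort C_UniformSpace) with C in *;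
  match goal with |- @eq _ ?a ?b => change (@eq C a b); field end.

(* Caratheodory's form of complex differentiability, with derivative [l]. *)
Definition cdiff (f : C -> C) (z l : C) : Prop :=
  exists h : C -> C, continuous h z /\ h z = l /\
    locally z (fun w => f w = (f z + (w - z) * h w)%C).

Lemma cdiff_continuous (f : C -> C) (z l : C) : cdiff f z l -> continuous f z.
Proof.
intros [h [Hc [_ He]]].
apply (continuous_ext_loc _ (fun w => (f z + (w - z) * h w)%C)).
- revert He; apply filter_imp; intros w Hw; now symmetry.
- apply continuous_Cplus; [apply continuous_const|]. apply continuous_Cmult; [|exact Hc].
  apply continuous_Cminus; [apply continuous_id|apply continuous_const].
Qed.

Lemma cdiff_ext_loc (f g : C -> C) (z l : C) :
  locally z (fun w => f w = g w) -> cdiff f z l -> cdiff g z l.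
Proof.
intros Hl [h [Hc [Hh He]]]. exists h; split; [exact Hc|split; [exact Hh|]].
rewrite <- (locally_singleton _ _ Hl).
generalize (filter_and _ _ Hl He). apply filter_imp. intros w [A B]. now rewrite <- A.
Qed.

Lemma cdiff_eq (f : C -> C) (z l m : C) : cdiff f z l -> l = m -> cdiff f z m.
Proof. now intros H <-. Qed.

Lemma cdiff_const (c z : C) : cdiff (fun _ => c) z 0%C.
Proof.
exists (fun _ => 0%C). split; [apply continuous_const|split; trivial].
apply filter_forall. intros w. cring.
Qed.

Lemma cdiff_id (z : C) : cdiff (fun w => w) z 1%C.
Proof.
exists (fun _ => 1%C). split; [apply continuous_const|split; trivial].
apply filter_forall. intros w. cring.
Qed.

Lemma cdiff_plus (f g : C -> C) (z l m : C) :
  cdiff f z l -> cdiff g z m -> cdiff (fun w => f w + g w)%C z (l + m)%C.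
Proof.
intros [h [Hc [Hh He]]] [k [Kc [Kh Ke]]]. exists (fun w => h w + k w)%C.
split; [now apply continuous_Cplus|split; [now rewrite Hh, Kh|]].
generalize (filter_and _ _ He Ke). apply filter_imp. intros w [A B]. rewrite A, B. cring.
Qed.

Lemma cdiff_mult (f g : C -> C) (z l m : C) :
  cdiff f z l -> cdiff g z m -> cdiff (fun w => f w * g w)%C z (l * g z + f z * m)%C.
Proof.
intros Hf Hg. assert (Cf := cdiff_continuous _ _ _ Hf).
destruct Hf as [h [Hc [Hh He]]]. destruct Hg as [k [Kc [Kh Ke]]].
exists (fun w => h w * g z + f w * k w)%C.
split.
- apply continuous_Cplus; apply continuous_Cmult; trivial. apply continuous_const.
- split; [now rewrite Hh, Kh|].
  generalize (filter_and _ _ He Ke). apply filter_imp. intros w [A B]. rewrite B, A. cring.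
Qed.

Lemma cdiff_scal (c : C) (f : C -> C) (z l : C) : cdiff f z l -> cdiff (fun w => c * f w)%C z (c * l)%C.
Proof.
intros H. replace (c * l)%C with (0 * f z + c * l)%C by cring.
apply (cdiff_mult (fun _ => c)); [apply cdiff_const|exact H].
Qed.

Lemma cdiff_minus (f g : C -> C) (z l m : C) :
  cdiff f z l -> cdiff g z m -> cdiff (fun w => f w - g w)%C z (l - m)%C.
Proof.
intros Hf Hg. replace (l - m)%C with (l + (-(1)) * m)%C by cring.
apply (cdiff_ext_loc (fun w => f w + (-(1)) * g w)%C).
- apply filter_forall; intros w; cring.
- apply cdiff_plus; [exact Hf|]. now apply cdiff_scal.
Qed.

(** Slopes multiply: [h (g w) * k w] is the slope of the composite, with no case distinction on
    [g w = g z]. *)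
Lemma cdiff_comp (f g : C -> C) (z l m : C) :
  cdiff g z m -> cdiff f (g z) l -> cdiff (fun w => f (g w)) z (l * m)%C.
Proof.
intros Hg [h [Hc [Hh He]]]. assert (Cg := cdiff_continuous _ _ _ Hg).
destruct Hg as [k [Kc [Kh Ke]]].
exists (fun w => h (g w) * k w)%C. split.
- apply continuous_Cmult; [|exact Kc]. now apply (continuous_comp g h).
- split; [now rewrite Hh, Kh|].
  generalize (filter_and _ _ Ke (Cg _ He)). apply filter_imp. intros w [A B].
  rewrite B. rewrite A at 1. cring.
Qed.

Lemma continuous_neq_0 {T : UniformSpace} (F : T -> C) (x : T) :
  continuous F x -> F x <> 0%C -> locally x (fun t => F t <> 0%C).
Proof.
intros H Hn. apply Cmod_gt_0 in Hn.
generalize (proj1 (continuous_C_Cmod F x) H _ Hn). apply filter_imp.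
intros t Ht E. rewrite E in Ht.
replace (0 - F x)%C with (- F x)%C in Ht by cring. rewrite Cmod_opp in Ht. lra.
Qed.

Lemma cdiff_inv (z : C) : z <> 0%C -> cdiff Cinv z (- / (z * z))%C.
Proof.
intros Hz. exists (fun w : C => - / (z * w))%C. split.
- apply continuous_Copp, continuous_Cinv.
  + apply continuous_Cmult; [apply continuous_const|apply continuous_id].
  + cbv beta. apply Cmult_neq_0; exact Hz.
- split; trivial.
  generalize (continuous_neq_0 (fun w : C => w) z (continuous_id _) Hz).
  apply filter_imp. intros w Hw. cfield. repeat split; assumption.
Qed.

Lemma cdiff_div (f g : C -> C) (z l m : C) :
  cdiff f z l -> cdiff g z m -> g z <> 0%C ->
  cdiff (fun w => f w / g w)%C z ((l * g z - f z * m) / (g z * g z))%C.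
Proof.
intros Hf Hg Hn.
replace ((l * g z - f z * m) / (g z * g z))%C
  with (l * / g z + f z * (- / (g z * g z) * m))%C by (cfield; exact Hn).
apply (cdiff_mult f (fun w => / g w)%C); [exact Hf|].
apply (cdiff_comp Cinv g); [exact Hg|now apply cdiff_inv].
Qed.

Lemma cdiff_of_has_cderiv (f : C -> C) (z l : C) : has_cderiv f z l -> cdiff f z l.
Proof.
intros [_ H].
exists (fun w => if Ceq_dec w z then l else ((f w - f z) / (w - z))%C).
split; [|split].
- apply continuous_C_Cmod. intros eps He.
  (* The derivative estimate is non-strict, so half of [eps] is requested. *)
  assert (He2 : 0 < eps / 2) by lra.
  specialize (H z (fun P HP => HP) (mkposreal _ He2)).
  apply (proj2 (locally_C _ _)) in H.
  revert H; apply filter_imp. intros w Hw. simpl in Hw.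
  destruct (Ceq_dec z z) as [_|N]; [|now destruct N].
  destruct (Ceq_dec w z) as [_|N].
  + replace (l - l)%C with (RtoC 0) by cring. rewrite Cmod_0. exact He.
  + assert (Hwz : (w - z)%C <> 0%C)
      by (intros E; apply N; replace w with (w - z + z)%C by cring; rewrite E; cring).
    change (Cmod (f w - f z - (w - z) * l) <= eps / 2 * Cmod (w - z)) in Hw.
    apply Cmod_gt_0 in Hwz as Hp.
    replace ((f w - f z) / (w - z) - l)%C with ((f w - f z - (w - z) * l) / (w - z))%C
      by (cfield; exact Hwz).
    rewrite Cmod_div by exact Hwz.
    apply Rle_lt_trans with (eps / 2); [|lra].
    apply Rle_div_l; assumption.
- destruct (Ceq_dec z z) as [_|N]; [trivial|now destruct N].
- apply filter_forall. intros w. destruct (Ceq_dec w z) as [->|N]; [cring|].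
  cfield. intros E; apply N; replace w with (w - z + z)%C by cring; rewrite E; cring.
Qed.

(** Restriction to the real axis: this is the bridge to the real mean value theorem along arcs. *)
Lemma cdiff_Re_is_derive (F : C -> C) (t : R) (l : C) :
  cdiff F t l -> is_derive (fun x : R => Re (F x)) t (Re l).
Proof.
intros [h [Hc [Hh He]]].
split; [apply is_linear_scal_l|].
intros x Hx.
apply (is_filter_lim_locally_unique (V := AbsRing_NormedModule R_AbsRing)) in Hx. subst x.
intros eps.
generalize (proj1 (continuous_C_Cmod h _) Hc _ (cond_pos eps)). intros Hd.
generalize (filter_and _ _ He Hd); clear He Hd. intros HH.
apply locally_C_Cmod in HH. destruct HH as [d [Hd HH]].
exists (mkposreal d Hd). intros w Hw.
change (Rabs (w - t) < d) in Hw.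
change (Rabs (Re (F w) - Re (F t) - (w - t) * Re l) <= eps * Rabs (w - t)).
destruct (HH (RtoC w)) as [A B].
{ rewrite <- RtoC_minus, Cmod_R. exact Hw. }
rewrite A. rewrite Hh in B.
replace (Re (F t + (RtoC w - RtoC t) * h (RtoC w))%C - Re (F t) - (w - t) * Re l)
  with (Re (h (RtoC w) - l)%C * (w - t))
  by (generalize (h (RtoC w)) (F (RtoC t)); intros p q; unfold Re; simpl; ring).
rewrite Rabs_mult. apply Rmult_le_compat_r; [apply Rabs_pos|].
left. eapply Rle_lt_trans; [apply re_le_Cmod|exact B].
Qed.

(** * Exponential and logarithm *)

Definition Cexp (z : C) : C := (exp (Re z) * cos (Im z), exp (Re z) * sin (Im z)).

Lemma Cexp_plus (z w : C) : Cexp (z + w) = (Cexp z * Cexp w)%C.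
Proof.
unfold Cexp, Cmult; destruct z as [x y], w as [u v]; simpl.
rewrite exp_plus, cos_plus, sin_plus. apply injective_projections; simpl; ring.
Qed.

Lemma Cexp_0 : Cexp 0 = 1%C.
Proof. unfold Cexp; simpl. rewrite exp_0, cos_0, sin_0, !Rmult_1_l. reflexivity. Qed.

Lemma Cmod_Cexp (z : C) : Cmod (Cexp z) = exp (Re z).
Proof.
unfold Cmod, Cexp; simpl fst; simpl snd.
replace ((exp (Re z) * cos (Im z)) ^ 2 + (exp (Re z) * sin (Im z)) ^ 2) with (exp (Re z) ^ 2).
- rewrite sqrt_pow2; [reflexivity|]. left; apply exp_pos.
- generalize (sin2_cos2 (Im z)); unfold Rsqr; intros H.
  replace ((exp (Re z) * cos (Im z)) ^ 2 + (exp (Re z) * sin (Im z)) ^ 2)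
    with (exp (Re z) ^ 2 * (sin (Im z) * sin (Im z) + cos (Im z) * cos (Im z))) by ring.
  rewrite H; ring.
Qed.

Lemma continuous_Cexp {T : UniformSpace} (F : T -> C) (x : T) :
  continuous F x -> continuous (fun t => Cexp (F t)) x.
Proof.
intros HF.
assert (A := continuous_Re _ _ HF). assert (B := continuous_Im _ _ HF).
assert (E : forall g, (forall u, derivable_pt g u) -> forall G : T -> R, continuous G x ->
  continuous (fun t => g (G t)) x).
{ intros g Hg G HG. apply continuous_C_comp_R; [exact HG|]. now apply derivable_continuous_pt. }
apply continuous_pair_C; simpl; apply continuous_Rmult.
- exact (E exp derivable_pt_exp _ A).
- exact (E cos derivable_pt_cos _ B).
- exact (E exp derivable_pt_exp _ A).
- exact (E sin derivable_pt_sin _ B).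
Qed.

Lemma Cmod_le_Rabs (z : C) : Cmod z <= Rabs (Re z) + Rabs (Im z).
Proof.
unfold Cmod, Re, Im. rewrite <- (sqrt_pow2 (Rabs (fst z) + Rabs (snd z))).
- apply sqrt_le_1_alt. rewrite <- (pow2_abs (fst z)), <- (pow2_abs (snd z)).
  generalize (Rabs_pos (fst z)) (Rabs_pos (snd z)); intros; nra.
- generalize (Rabs_pos (fst z)) (Rabs_pos (snd z)); lra.
Qed.

Lemma Im_le_Cmod (z : C) : Rabs (Im z) <= Cmod z.
Proof. eapply Rle_trans; [apply Rmax_r|apply Rmax_Cmod]. Qed.

(** [1 + u <= exp u] at [u = x] gives the lower bound; at [u = - x] it gives
    [exp x - 1 <= x * exp x], hence [exp x - 1 - x <= (exp x - 1) * x], and [exp x <= 2] on this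
    range. *)
Lemma exp_minus_1_bound (x : R) : Rabs x <= 1 / 2 -> 0 <= exp x - 1 - x <= 2 * x ^ 2.
Proof.
intros Hx. apply Rabs_le_between in Hx.
assert (A := exp_ineq1_le x). assert (B := exp_ineq1_le (- x)).
rewrite exp_Ropp in B. assert (P := exp_pos x). split; [lra|].
assert (Hq : exp x * (1 - x) <= 1).
{ replace 1 with (exp x * / exp x) at 2 by (field; lra). apply Rmult_le_compat_l; lra. }
assert (exp x <= 2) by nra.
assert (exp x - 1 - x <= exp x * x - x) by lra.
assert ((exp x - 1) * x <= 2 * x ^ 2); [|lra].
destruct (Rle_dec 0 x).
- assert (exp x - 1 <= 2 * x) by nra. nra.
- assert (exp x - 1 >= 2 * x) by nra. nra.
Qed.

Lemma cos_minus_1_bound (y : R) : 0 <= 1 - cos y <= y ^ 2 / 2.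
Proof.
split; [generalize (COS_bound y); lra|].
replace y with (2 * (y / 2)) at 1 by field. rewrite cos_2a_sin.
assert (Rabs (sin (y / 2)) <= Rabs (y / 2)).
{ destruct (MVT_gen sin 0 (y / 2) cos) as [c [_ Hc]].
  - intros; apply is_derive_Reals, derivable_pt_lim_sin.
  - intros; apply continuity_sin.
  - rewrite sin_0, !Rminus_0_r in Hc. rewrite Hc, Rabs_mult.
    rewrite <- (Rmult_1_l (Rabs (y / 2))) at 2.
    apply Rmult_le_compat_r; [apply Rabs_pos|]. apply Rabs_le, COS_bound. }
apply Rsqr_le_abs_1 in H. unfold Rsqr in H. nra.
Qed.

Lemma sin_minus_id_bound (y : R) : Rabs (sin y - y) <= y ^ 2 / 2 * Rabs y.
Proof.
destruct (MVT_gen (fun t => sin t - t) 0 y (fun t => cos t - 1)) as [c [Hb Hc]].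
- intros x _. auto_derive; trivial. ring.
- intros x _. apply continuity_pt_minus; [apply continuity_sin|].
  apply derivable_continuous_pt, derivable_pt_id.
- rewrite sin_0, !Rminus_0_r in Hc. rewrite Hc, Rabs_mult.
  apply Rmult_le_compat_r; [apply Rabs_pos|].
  destruct (cos_minus_1_bound c) as [H1 H2].
  rewrite Rabs_left1 by lra.
  assert (c ^ 2 <= y ^ 2); [|lra].
  revert Hb; unfold Rmin, Rmax; destruct (Rle_dec 0 y); intros.
  + nra.
  + assert (0 <= (c - y) * (- c - y)) by (apply Rmult_le_pos; lra). nra.
Qed.

(** A quadratic remainder, as differentiability at [0] requires. The constant is [4 + 6], from the
    real and the imaginary part; no sharpness is sought. *)
Lemma Cexp_bound (w : C) : Cmod w <= 1 / 2 -> Cmod (Cexp w - 1 - w) <= 10 * Cmod w ^ 2.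
Proof.
intros Hw. eapply Rle_trans; [apply Cmod_le_Rabs|].
assert (A := re_le_Cmod w). assert (B := Im_le_Cmod w).
assert (M := Cmod_ge_0 w). revert Hw A B M. generalize (Cmod w). intros m Hw A B M.
destruct w as [x y]. unfold Re, Im in *. simpl in *.
assert (X2 : x ^ 2 <= m ^ 2) by (rewrite <- (pow2_abs x); generalize (Rabs_pos x); intros; nra).
assert (Y2 : y ^ 2 <= m ^ 2) by (rewrite <- (pow2_abs y); generalize (Rabs_pos y); intros; nra).
destruct (exp_minus_1_bound x) as [E1 E2]; [lra|].
assert (Hx := A). apply Rabs_le_between in Hx.
assert (Hy := B). apply Rabs_le_between in Hy.
destruct (cos_minus_1_bound y) as [C1 C2]. assert (S := sin_minus_id_bound y).
assert (P := exp_pos x).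
assert (P2 : exp x <= 2) by nra.
assert (S' : Rabs (sin y - y) <= m ^ 2 / 4).
{ eapply Rle_trans; [exact S|]. generalize (Rabs_pos y); intros; nra. }
apply Rabs_le_between in S'.
assert (L1 : Rabs (exp x * cos y + - (1) + - x) <= 4 * m ^ 2).
{ replace (exp x * cos y + - (1) + - x) with (exp x - 1 - x - exp x * (1 - cos y)) by ring.
  assert (0 <= exp x * (1 - cos y) <= m ^ 2) by (split; nra).
  apply Rabs_le; nra. }
assert (L2 : Rabs (exp x * sin y + - 0 + - y) <= 6 * m ^ 2).
{ replace (exp x * sin y + - 0 + - y) with (exp x * (sin y - y) + (exp x - 1) * y) by ring.
  assert (- (m ^ 2) <= exp x * (sin y - y) <= m ^ 2) by (split; nra).
  assert (- (2 * m) <= exp x - 1 <= 2 * m) by (split; nra).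
  assert (- (2 * m ^ 2) <= (exp x - 1) * y <= 2 * m ^ 2) by (split; nra).
  apply Rabs_le; nra. }
simpl in L1, L2. lra.
Qed.

Lemma C_minus_eq_0 (w z : C) : (w - z)%C = 0%C -> w = z.
Proof. intros E. replace w with (w - z + z)%C by ring. rewrite E; ring. Qed.

Lemma cdiff_Cexp_0 : cdiff Cexp 0 1.
Proof.
exists (fun w => if Ceq_dec w 0 then RtoC 1 else ((Cexp w - 1) / w)%C).
assert (H0 : (if Ceq_dec 0 0 then RtoC 1 else ((Cexp 0 - 1) / 0)%C) = 1%C)
  by (destruct (Ceq_dec 0 0) as [_|N]; [reflexivity|now destruct N]).
split; [|split].
- apply continuous_C_Cmod. intros eps He.
  apply locally_C_Cmod. exists (Rmin (1 / 2) (eps / 11)).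
  split; [apply Rmin_pos; lra|].
  intros w Hw. rewrite H0. replace (w - 0)%C with w in Hw by ring.
  assert (W1 : Cmod w < 1 / 2) by (eapply Rlt_le_trans; [exact Hw|apply Rmin_l]).
  assert (W2 : Cmod w < eps / 11) by (eapply Rlt_le_trans; [exact Hw|apply Rmin_r]).
  destruct (Ceq_dec w 0) as [E|N].
  + replace (1 - 1)%C with (RtoC 0) by ring. rewrite Cmod_0. exact He.
  + replace ((Cexp w - 1) / w - 1)%C with ((Cexp w - 1 - w) / w)%C by (field; exact N).
    rewrite Cmod_div by exact N. apply Cmod_gt_0 in N as P.
    apply Rlt_div_l; [exact P|].
    assert (B := Cexp_bound w (Rlt_le _ _ W1)). nra.
- exact H0.
- apply filter_forall. intros w. rewrite Cexp_0.
  destruct (Ceq_dec w 0) as [->|N]; [rewrite Cexp_0; cring|]. cfield. exact N.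
Qed.

Lemma cdiff_Cexp (z : C) : cdiff Cexp z (Cexp z).
Proof.
apply (cdiff_ext_loc (fun w => Cexp z * Cexp (w - z))%C).
- apply filter_forall. intros w. rewrite <- Cexp_plus. f_equal. cring.
- apply cdiff_eq with (Cexp z * (1 * (1 - 0)))%C; [|ring].
  apply (cdiff_scal (Cexp z) (fun w => Cexp (w - z))).
  apply (cdiff_comp Cexp (fun w => w - z)%C).
  + apply cdiff_minus; [apply cdiff_id|apply cdiff_const].
  + replace (z - z)%C with (RtoC 0) by ring. exact cdiff_Cexp_0.
Qed.

(* Principal branch on the right half-plane; meaningless when [Re w <= 0]. *)
Definition Clog (w : C) : C := (ln (Cmod w), atan (Im w / Re w)).

Lemma Re_pos_neq_0 (w : C) : 0 < Re w -> w <> 0%C.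
Proof. intros H E. rewrite E in H. simpl in H. lra. Qed.

Lemma Cexp_Clog (w : C) : 0 < Re w -> Cexp (Clog w) = w.
Proof.
intros H. assert (Hm := proj1 (Cmod_gt_0 w) (Re_pos_neq_0 w H)).
unfold Cexp, Clog. simpl. rewrite exp_ln by exact Hm.
rewrite cos_atan, sin_atan.
assert (E : Cmod w = Re w * sqrt (1 + (Im w / Re w)²)).
{ rewrite <- (sqrt_pow2 (Re w)) at 1 by lra. rewrite <- sqrt_mult_alt by apply pow2_ge_0.
  unfold Cmod. f_equal. unfold Rsqr. unfold Re, Im in *. field. lra. }
assert (S : 0 < sqrt (1 + (Im w / Re w)²)).
{ apply sqrt_lt_R0. generalize (Rle_0_sqr (Im w / Re w)). lra. }
rewrite E. destruct w as [x y]; unfold Re, Im in *; simpl in *.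
apply injective_projections; simpl; field; lra.
Qed.

Lemma Clog_Cexp (z : C) : - (PI / 2) < Im z < PI / 2 -> Clog (Cexp z) = z.
Proof.
intros H. assert (Hc : 0 < cos (Im z)) by (apply cos_gt_0; lra).
assert (P := exp_pos (Re z)).
unfold Clog. rewrite Cmod_Cexp, ln_exp. unfold Cexp; simpl.
replace (exp (Re z) * sin (Im z) / (exp (Re z) * cos (Im z))) with (tan (Im z))
  by (unfold tan; field; split; lra).
rewrite atan_tan by lra. now destruct z.
Qed.

Lemma continuous_Clog {T : UniformSpace} (F : T -> C) (x : T) :
  continuous F x -> 0 < Re (F x) -> continuous (fun t => Clog (F t)) x.
Proof.
intros HF H. assert (A := continuous_Re _ _ HF). assert (B := continuous_Im _ _ HF).
apply continuous_pair_C; simpl.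
- apply (continuous_C_comp_R (fun t => Cmod (F t)) ln); [now apply continuous_Cmod|].
  apply derivable_continuous_pt. eexists. apply derivable_pt_lim_ln.
  now apply Cmod_gt_0, Re_pos_neq_0.
- apply (continuous_C_comp_R (fun t => Im (F t) / Re (F t)) atan).
  + apply continuous_Rmult; [exact B|].
    apply (continuous_C_comp_R (fun t => Re (F t)) Rinv); [exact A|].
    apply continuity_pt_inv; [apply derivable_continuous_pt, derivable_pt_id|].
    unfold id; lra.
  + apply derivable_continuous_pt, derivable_pt_atan.
Qed.

Lemma locally_Re_pos {T : UniformSpace} (F : T -> C) (x : T) :
  continuous F x -> 0 < Re (F x) -> locally x (fun t => 0 < Re (F t)).
Proof.
intros HF H. apply (continuous_Re _ _ HF (fun y => 0 < y)). now apply open_gt.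
Qed.

(** Inverse function rule for slopes: if [h] is the slope of [Cexp] at [Clog w], then [/ h (Clog v)]
    is the slope of [Clog] at [w]. Continuity of [Clog], read off its real formula, makes this slope
    continuous. *)
Lemma cdiff_Clog (w : C) : 0 < Re w -> cdiff Clog w (/ w)%C.
Proof.
intros H. assert (Hc := continuous_Clog (fun t : C => t) w (continuous_id _) H).
destruct (cdiff_Cexp (Clog w)) as [h [Hh [Hv He]]].
rewrite Cexp_Clog in Hv by exact H.
assert (Hn : w <> 0%C) by now apply Re_pos_neq_0.
assert (Hhc : continuous (fun v => h (Clog v)) w) by now apply (continuous_comp Clog h).
exists (fun v => / h (Clog v))%C. split; [|split].
- apply continuous_Cinv; [exact Hhc|]. cbv beta. now rewrite Hv.
- now rewrite Hv.
- assert (He' : locally w (fun v => Cexp (Clog v) =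
    (Cexp (Clog w) + (Clog v - Clog w) * h (Clog v))%C)) by exact (Hc _ He).
  generalize (filter_and _ _ He' (filter_and _ _
    (locally_Re_pos (fun t : C => t) w (continuous_id _) H)
    (continuous_neq_0 _ _ Hhc ltac:(cbv beta; now rewrite Hv)))).
  apply filter_imp. intros v [A [B D]].
  rewrite (Cexp_Clog v B), (Cexp_Clog w H) in A.
  rewrite A at 2. cfield. exact D.
Qed.

(** * Goursat's theorem on rectangles *)

Lemma nested_intervals (a b : nat -> R) :
  (forall n, a n <= a (S n)) -> (forall n, b (S n) <= b n) -> (forall n, a n <= b n) ->
  exists x, forall n, a n <= x <= b n.
Proof.
intros Ha Hb Hab.
assert (Ha' : forall n m, (n <= m)%nat -> a n <= a m)
  by (intros n m H; induction H as [|m H IH]; [lra|]; generalize (Ha m); lra).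
assert (Hb' : forall n m, (n <= m)%nat -> b m <= b n)
  by (intros n m H; induction H as [|m H IH]; [lra|]; generalize (Hb m); lra).
assert (H : forall n m, a n <= b m).
{ intros n m. apply Rle_trans with (a (max n m)); [apply Ha'; lia|].
  apply Rle_trans with (b (max n m)); [apply Hab|apply Hb'; lia]. }
destruct (completeness (fun x => exists n, x = a n)) as [x [U L]].
- exists (b 0%nat). intros y [n ->]. apply H.
- exists (a 0%nat). now exists 0%nat.
- exists x. intros n. split; [apply U; now exists n|].
  apply L. intros y [m ->]. apply H.
Qed.

(* A rectangle [[a,b] x [c,d]] is encoded as [((a,b),(c,d))]. *)
Definition halve_left (N : (R * R) * (R * R) -> R) (q : (R * R) * (R * R)) :=
  let '((a, b), J) := q in
  let m := (a + b) / 2 in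
  if Rle_dec (N q) (2 * N ((a, m), J)) then ((a, m), J) else ((m, b), J).

Definition halve_right (N : (R * R) * (R * R) -> R) (q : (R * R) * (R * R)) :=
  let '(J, (c, d)) := q in
  let m := (c + d) / 2 in
  if Rle_dec (N q) (2 * N (J, (c, m))) then (J, (c, m)) else (J, (m, d)).

Fixpoint quarters (N : (R * R) * (R * R) -> R) (q : (R * R) * (R * R)) (n : nat) :=
  match n with
  | O => q
  | S k => halve_right N (halve_left N (quarters N q k))
  end.

(** Subadditivity leaves, at each cut, a half carrying at least half of [N]. After [n] quarterings
    [N] has dropped at most by [4 ^ n], while the squared half-perimeter has dropped by exactly
    [4 ^ n]. A positive [N] thus contradicts the local estimate at the common point of the
    rectangles. *)
Lemma bisection_principle (N : (R * R) * (R * R) -> R) (a0 b0 c0 d0 : R) :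
  a0 <= b0 -> c0 <= d0 ->
  (forall a m b c d, a0 <= a <= m -> m <= b <= b0 -> c0 <= c <= d -> d <= d0 ->
     N ((a, b), (c, d)) <= N ((a, m), (c, d)) + N ((m, b), (c, d))) ->
  (forall a b c m d, a0 <= a <= b -> b <= b0 -> c0 <= c <= m -> m <= d <= d0 ->
     N ((a, b), (c, d)) <= N ((a, b), (c, m)) + N ((a, b), (m, d))) ->
  (forall x y, a0 <= x <= b0 -> c0 <= y <= d0 -> forall eps, 0 < eps ->
     exists del, 0 < del /\
     forall a b c d, a0 <= a <= x -> x <= b <= b0 -> c0 <= c <= y -> y <= d <= d0 ->
       b - a < del -> d - c < del ->
       N ((a, b), (c, d)) <= eps * ((b - a) + (d - c)) ^ 2) ->
  N ((a0, b0), (c0, d0)) <= 0.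
Proof.
intros Hab Hcd Hh Hv Hloc.
apply Rnot_lt_le. intros Hpos.
set (q := quarters N ((a0, b0), (c0, d0))).
set (a := fun n => fst (fst (q n))). set (b := fun n => snd (fst (q n))).
set (c := fun n => fst (snd (q n))). set (d := fun n => snd (snd (q n))).
assert (Hq : forall n, q n = ((a n, b n), (c n, d n)))
  by (intros n; unfold a, b, c, d; now destruct (q n) as [[? ?] [? ?]]).
assert (Step : forall n, a0 <= a n <= b n -> b n <= b0 -> c0 <= c n <= d n -> d n <= d0 ->
  (a n <= a (S n) /\ b (S n) <= b n /\ c n <= c (S n) /\ d (S n) <= d n) /\
  b (S n) - a (S n) = (b n - a n) / 2 /\ d (S n) - c (S n) = (d n - c n) / 2 /\
  N (q n) <= 4 * N (q (S n))).
{ intros n A B D E.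
  assert (Hs : q (S n) = halve_right N (halve_left N ((a n, b n), (c n, d n))))
    by (rewrite <- Hq; reflexivity).
  rewrite (Hq n). rewrite (Hq (S n)) in *. revert Hs A B D E.
  generalize (a n) (b n) (c n) (d n) (a (S n)) (b (S n)) (c (S n)) (d (S n)).
  clear - Hh Hv. intros a b c d a' b' c' d' Hs A B D E.
  assert (H1 := Hh a ((a + b) / 2) b c d ltac:(lra) ltac:(lra) ltac:(lra) ltac:(lra)).
  simpl in Hs.
  destruct (Rle_dec (N (a, b, (c, d))) (2 * N (a, (a + b) / 2, (c, d)))) as [L|L]; simpl in Hs.
  - assert (H2 := Hv a ((a + b) / 2) c ((c + d) / 2) d ltac:(lra) ltac:(lra) ltac:(lra) ltac:(lra)).
    destruct (Rle_dec (N (a, (a + b) / 2, (c, d))) (2 * N (a, (a + b) / 2, (c, (c + d) / 2))))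
      as [M|M]; injection Hs; intros -> -> -> ->; repeat split; lra.
  - assert (H2 := Hv ((a + b) / 2) b c ((c + d) / 2) d ltac:(lra) ltac:(lra) ltac:(lra) ltac:(lra)).
    destruct (Rle_dec (N ((a + b) / 2, b, (c, d))) (2 * N ((a + b) / 2, b, (c, (c + d) / 2))))
      as [M|M]; injection Hs; intros -> -> -> ->; repeat split; lra. }
assert (Inv : forall n, (a0 <= a n <= b n /\ b n <= b0 /\ c0 <= c n <= d n /\ d n <= d0) /\
  b n - a n = (b0 - a0) * (1 / 2) ^ n /\ d n - c n = (d0 - c0) * (1 / 2) ^ n /\
  N ((a0, b0), (c0, d0)) * ((1 / 2) ^ n * (1 / 2) ^ n) <= N (q n)).
{ induction n as [|n [[A [B [D E]]] [F [G I]]]].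
  - unfold a, b, c, d, q; simpl. lra.
  - destruct (Step n A B D E) as [[S1 [S2 [S3 S4]]] [S5 [S6 S7]]].
    simpl pow. repeat split; lra. }
destruct (nested_intervals a b) as [x Hx]; try (intros n; destruct (Inv n) as [[A [B [D E]]] _];
  destruct (Step n A B D E); lra).
destruct (nested_intervals c d) as [y Hy]; try (intros n; destruct (Inv n) as [[A [B [D E]]] _];
  destruct (Step n A B D E); lra).
set (P := (b0 - a0) + (d0 - c0)).
assert (HP : 0 <= P) by (unfold P; lra).
set (K := N ((a0, b0), (c0, d0))) in *.
assert (HP2 := pow2_ge_0 P).
(* With this [eps] the product [eps * P ^ 2] is below [K]; the [+ 1] keeps the denominator positive
   when the rectangle is a point. *)
destruct (Hloc x y) with (eps := K / (2 * (P ^ 2 + 1))) as [del [Hdel Hl]].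
- apply (Hx 0%nat).
- apply (Hy 0%nat).
- apply Rdiv_lt_0_compat; lra.
- destruct (pow_lt_1_zero (1 / 2)) with (y := del / (P + 1)) as [n Hn].
  + rewrite Rabs_pos_eq; lra.
  + apply Rdiv_lt_0_compat; lra.
  + specialize (Hn n (le_n n)).
    assert (Hp : 0 < (1 / 2) ^ n) by (apply pow_lt; lra).
    rewrite Rabs_pos_eq in Hn by lra.
    apply Rlt_div_r in Hn; [|lra].
    destruct (Inv n) as [[A [B [D E]]] [F [G I]]].
    specialize (Hl (a n) (b n) (c n) (d n)).
    rewrite <- Hq in Hl. rewrite F, G in Hl.
    replace ((b0 - a0) * (1 / 2) ^ n + (d0 - c0) * (1 / 2) ^ n) with (P * (1 / 2) ^ n) in Hl
      by (unfold P; ring).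
    assert (L := Hl ltac:(generalize (Hx n); lra) ltac:(generalize (Hx n); lra)
      ltac:(generalize (Hy n); lra) ltac:(generalize (Hy n); lra)
      ltac:(unfold P in *; nra) ltac:(unfold P in *; nra)).
    assert (M : K <= K / (2 * (P ^ 2 + 1)) * P ^ 2).
    { apply Rmult_le_reg_r with ((1 / 2) ^ n * (1 / 2) ^ n); [now apply Rmult_lt_0_compat|].
      eapply Rle_trans; [exact I|]. eapply Rle_trans; [exact L|]. right; ring. }
    replace (K / (2 * (P ^ 2 + 1)) * P ^ 2) with (K * (P ^ 2 / (2 * (P ^ 2 + 1)))) in M
      by (field; lra).
    assert (P ^ 2 / (2 * (P ^ 2 + 1)) < 1) by (apply Rlt_div_l; lra).
    nra.
Qed.

Lemma RInt_near_const (g : R -> R) (a b k M : R) :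
  a <= b -> (forall x, a <= x <= b -> continuous g x) ->
  (forall x, a <= x <= b -> Rabs (g x - k) <= M) ->
  Rabs (RInt g a b - k * (b - a)) <= (b - a) * M.
Proof.
intros Hab Hc HM.
assert (Hi : ex_RInt g a b).
{ apply (ex_RInt_continuous (V := R_CompleteNormedModule)). intros x Hx.
  rewrite Rmin_left, Rmax_right in Hx by exact Hab. now apply Hc. }
apply (norm_RInt_le_const (V := R_NormedModule) (fun x => g x - k) a b _ M Hab HM).
replace (k * (b - a)) with (scal (b - a) k) by (unfold scal; simpl; unfold mult; simpl; ring).
apply (is_RInt_minus (V := R_NormedModule)).
- apply (RInt_correct (V := R_CompleteNormedModule)). exact Hi.
- apply (is_RInt_const (V := R_NormedModule)).
Qed.

(* Imaginary part of the integral of [G] along the boundary of the rectangle. *)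
Definition Im_boundary_RInt (G : C -> C) (q : (R * R) * (R * R)) : R :=
  let '((a, b), (c, d)) := q in
  RInt (fun x => Im (G (x, c)) - Im (G (x, d))) a b
  + RInt (fun y => Re (G (b, y)) - Re (G (a, y))) c d.

Lemma continuous_C_mk {T : UniformSpace} (f g : T -> R) (t : T) :
  continuous f t -> continuous g t -> continuous (fun s => (f s, g s) : C) t.
Proof. intros Hf Hg; now apply continuous_pair_C. Qed.

(** The imaginary part suffices later: on vertical sides it integrates [Re G], which in the
    coordinate [log z] is the circle integral of a real part. *)
Lemma goursat (G : C -> C) (a0 b0 c0 d0 : R) :
  a0 <= b0 -> c0 <= d0 ->
  (forall x y, a0 <= x <= b0 -> c0 <= y <= d0 -> exists l, cdiff G (x, y) l) ->
  Im_boundary_RInt G ((a0, b0), (c0, d0)) = 0.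
Proof.
intros Hab Hcd HG.
assert (CG : forall x y, a0 <= x <= b0 -> c0 <= y <= d0 -> continuous G (x, y)).
{ intros x y Hx Hy. destruct (HG x y Hx Hy) as [l Hl]. now apply cdiff_continuous in Hl. }
assert (CH : forall x y, a0 <= x <= b0 -> c0 <= y <= d0 -> continuous (fun t => G (t, y)) x).
{ intros x y Hx Hy. apply (continuous_comp (fun t => (t, y) : C) G); [|now apply CG].
  apply continuous_C_mk; [apply continuous_id|apply continuous_const]. }
assert (CV : forall x y, a0 <= x <= b0 -> c0 <= y <= d0 -> continuous (fun t => G (x, t)) y).
{ intros x y Hx Hy. apply (continuous_comp (fun t => (x, t) : C) G); [|now apply CG].
  apply continuous_C_mk; [apply continuous_const|apply continuous_id]. }
assert (CI : forall c d x, c0 <= c <= d0 -> c0 <= d <= d0 -> a0 <= x <= b0 ->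
  continuous (fun x => Im (G (x, c)) - Im (G (x, d))) x).
{ intros c d x Hc Hd Hx. apply continuous_Rminus.
  - apply (continuous_Im (fun x => G (x, c))). now apply CH.
  - apply (continuous_Im (fun x => G (x, d))). now apply CH. }
assert (CR : forall a b y, a0 <= a <= b0 -> a0 <= b <= b0 -> c0 <= y <= d0 ->
  continuous (fun y => Re (G (b, y)) - Re (G (a, y))) y).
{ intros a b y Ha Hb Hy. apply continuous_Rminus.
  - apply (continuous_Re (fun y => G (b, y))). now apply CV.
  - apply (continuous_Re (fun y => G (a, y))). now apply CV. }
assert (II : forall c d x x', c0 <= c <= d0 -> c0 <= d <= d0 -> a0 <= x <= x' -> x' <= b0 ->
  ex_RInt (fun x => Im (G (x, c)) - Im (G (x, d))) x x').
{ intros c d x x' Hc Hd Hx Hx'. apply (ex_RInt_continuous (V := R_CompleteNormedModule)).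
  intros t Ht. rewrite Rmin_left, Rmax_right in Ht by lra. apply CI; lra. }
assert (IR : forall a b y y', a0 <= a <= b0 -> a0 <= b <= b0 -> c0 <= y <= y' -> y' <= d0 ->
  ex_RInt (fun y => Re (G (b, y)) - Re (G (a, y))) y y').
{ intros a b y y' Ha Hb Hy Hy'. apply (ex_RInt_continuous (V := R_CompleteNormedModule)).
  intros t Ht. rewrite Rmin_left, Rmax_right in Ht by lra. apply CR; lra. }
apply Rabs_eq_0, Rle_antisym; [|apply Rabs_pos].
apply (bisection_principle (fun q => Rabs (Im_boundary_RInt G q))); try assumption.
- intros a m b c d Ha Hm Hc Hd. eapply Rle_trans; [|apply Rabs_triang]. right; f_equal.
  unfold Im_boundary_RInt.
  rewrite <- (RInt_Chasles (V := R_CompleteNormedModule) _ a m b) by (apply II; lra).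
  rewrite (RInt_ext (fun y => Re (G (b, y)) - Re (G (a, y)))
    (fun y => plus (Re (G (m, y)) - Re (G (a, y))) (Re (G (b, y)) - Re (G (m, y)))))
    by (intros y _; unfold plus; cbn -[Re Im RInt]; ring).
  rewrite (RInt_plus (V := R_CompleteNormedModule)) by (apply IR; lra).
  unfold plus; cbn -[Re Im RInt]; ring.
- intros a b c m d Ha Hb Hc Hm. eapply Rle_trans; [|apply Rabs_triang]. right; f_equal.
  unfold Im_boundary_RInt.
  rewrite <- (RInt_Chasles (V := R_CompleteNormedModule) _ c m d) by (apply IR; lra).
  rewrite (RInt_ext (fun x => Im (G (x, c)) - Im (G (x, d)))
    (fun x => plus (Im (G (x, c)) - Im (G (x, m))) (Im (G (x, m)) - Im (G (x, d)))))
    by (intros y _; unfold plus; cbn -[Re Im RInt]; ring).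
  rewrite (RInt_plus (V := R_CompleteNormedModule)) by (apply II; lra).
  unfold plus; cbn -[Re Im RInt]; ring.
- intros x y Hx Hy eps Heps.
  destruct (HG x y Hx Hy) as [l [h [Hc [Hh He]]]].
  assert (He2 : 0 < eps / 2) by lra.
  generalize (filter_and _ _ He (proj1 (continuous_C_Cmod h _) Hc _ He2)). clear He. intros He.
  apply locally_C_Cmod in He. destruct He as [del [Hdel He]].
  exists (del / 2). split; [lra|].
  intros a b c d Ha Hb Hc' Hd Lx Ly.
  assert (Hmod : forall u v, a <= u <= b -> c <= v <= d ->
    exists e, G (u, v) = (G (x, y) + l * ((u, v) - (x, y)) + e)%C
      /\ Cmod e <= eps / 2 * ((b - a) + (d - c))).
  { intros u v Hu Hv.
    assert (Hd' : Cmod ((u, v) - (x, y))%C <= (b - a) + (d - c)).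
    { eapply Rle_trans; [apply Cmod_le_Rabs|]. simpl.
      apply Rplus_le_compat; apply Rabs_le; lra. }
    destruct (He (u, v)) as [E1 E2]; [lra|].
    exists (((u, v) - (x, y)) * (h (u, v) - l))%C. split.
    - rewrite E1 at 1. cring.
    - rewrite Hh in E2. rewrite Cmod_mult, Rmult_comm.
      apply Rmult_le_compat; try apply Cmod_ge_0; lra. }
  unfold Im_boundary_RInt.
  (* Opposite sides are paired in one integrand, so the affine part of [G] contributes only the
     constant [Re l * (c - d)] here and [Re l * (b - a)] on the vertical pair. After integration
     these cancel, and the errors add up to [eps] times the squared half-perimeter. *)
  assert (B1 : Rabs (RInt (fun x => Im (G (x, c)) - Im (G (x, d))) a b - (Re l * (c - d)) * (b - a))
    <= (b - a) * (eps * ((b - a) + (d - c)))).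
  { apply RInt_near_const; [lra|intros; apply CI; lra|]. intros t Ht.
    destruct (Hmod t c) as [e1 [-> M1]]; [lra|lra|].
    destruct (Hmod t d) as [e2 [-> M2]]; [lra|lra|].
    assert (N1 := Im_le_Cmod e1). assert (N2 := Im_le_Cmod e2).
    apply Rabs_le_between in N1. apply Rabs_le_between in N2.
    apply Rabs_le. clear - M1 M2 N1 N2. unfold Im, Re in *; simpl.
    destruct l as [l1 l2], (G (x, y)) as [g1 g2], e1, e2; simpl in *. lra. }
  assert (B2 : Rabs (RInt (fun y => Re (G (b, y)) - Re (G (a, y))) c d - (Re l * (b - a)) * (d - c))
    <= (d - c) * (eps * ((b - a) + (d - c)))).
  { apply RInt_near_const; [lra|intros; apply CR; lra|]. intros t Ht.
    destruct (Hmod a t) as [e1 [-> M1]]; [lra|lra|].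
    destruct (Hmod b t) as [e2 [-> M2]]; [lra|lra|].
    assert (N1 := re_le_Cmod e1). assert (N2 := re_le_Cmod e2).
    apply Rabs_le_between in N1. apply Rabs_le_between in N2.
    apply Rabs_le. clear - M1 M2 N1 N2. unfold Im, Re in *; simpl.
    destruct l as [l1 l2], (G (x, y)) as [g1 g2], e1, e2; simpl in *. lra. }
  apply Rabs_le_between in B1. apply Rabs_le_between in B2. apply Rabs_le.
  split; lra.
Qed.

(** * Mean values on circles and the Schwarz lemma *)

Definition polar (r t : R) : C := (r * cos t, r * sin t).

Lemma Cmod_polar (r t : R) : 0 <= r -> Cmod (polar r t) = r.
Proof.
intros Hr. unfold Cmod, polar; simpl fst; simpl snd.
generalize (sin2_cos2 t); unfold Rsqr; intros H.
replace ((r * cos t) ^ 2 + (r * sin t) ^ 2) with (r ^ 2 * (sin t * sin t + cos t * cos t)) by ring.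
rewrite H, Rmult_1_r. now apply sqrt_pow2.
Qed.

Lemma continuous_polar {T : UniformSpace} (f g : T -> R) (x : T) :
  continuous f x -> continuous g x -> continuous (fun s => polar (f s) (g s)) x.
Proof.
intros Hf Hg. unfold polar. apply continuous_C_mk; apply continuous_Rmult; trivial.
- apply (continuous_C_comp_R g cos); [exact Hg|apply continuity_cos].
- apply (continuous_C_comp_R g sin); [exact Hg|apply continuity_sin].
Qed.

Definition circle_int (K : C -> C) (r : R) : R := RInt (fun t => Re (K (polar r t))) 0 (2 * PI).

Lemma ex_circle_int (K : C -> C) (r : R) :
  0 <= r -> (forall z, Cmod z = r -> continuous K z) ->
  ex_RInt (fun t => Re (K (polar r t))) 0 (2 * PI).
Proof.
intros Hr HK. apply (ex_RInt_continuous (V := R_CompleteNormedModule)). intros t _.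
apply continuous_Re. apply (continuous_comp (fun t => polar r t) K).
- apply continuous_polar; [apply continuous_const|apply continuous_id].
- apply HK. now apply Cmod_polar.
Qed.

(** Under [Cexp] the annulus is the image of a rectangle of height [2 * PI]. The horizontal sides
    cancel by periodicity; the vertical sides are the two circle integrals. *)
Lemma circle_int_annulus (K : C -> C) (r1 r2 : R) :
  0 < r1 <= r2 ->
  (forall z, r1 <= Cmod z <= r2 -> exists l, cdiff K z l) ->
  circle_int K r1 = circle_int K r2.
Proof.
intros Hr HK. assert (Hpi := PI_RGT_0).
assert (HC : forall z, r1 <= Cmod z <= r2 -> continuous K z)
  by (intros z Hz; destruct (HK z Hz) as [l Hl]; now apply cdiff_continuous in Hl).
assert (E : forall r t, 0 < r -> Cexp (ln r, t) = polar r t)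
  by (intros r t H; unfold Cexp, polar; simpl; now rewrite exp_ln).
assert (H : Im_boundary_RInt (fun z => K (Cexp z)) ((ln r1, ln r2), (0, 2 * PI)) = 0).
{ apply goursat.
  - destruct (Req_dec r1 r2) as [->|N]; [lra|]. left; apply ln_increasing; lra.
  - lra.
  - intros x y Hx Hy.
    destruct (HK (Cexp (x, y))) as [l Hl].
    + rewrite Cmod_Cexp. simpl.
      rewrite <- (exp_ln r1), <- (exp_ln r2) by lra.
      split; [destruct (Req_dec (ln r1) x) as [->|]|destruct (Req_dec x (ln r2)) as [->|]];
        try lra; left; apply exp_increasing; lra.
    + eexists. apply cdiff_comp with (g := Cexp); [apply cdiff_Cexp|exact Hl]. }
unfold Im_boundary_RInt in H.
rewrite (RInt_ext (fun x => Im (K (Cexp (x, 0))) - Im (K (Cexp (x, 2 * PI)))) (fun _ => 0)) in H.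
2: { intros x _. replace (Cexp (x, 2 * PI)) with (Cexp (x, 0)); [apply Rminus_diag|].
  unfold Cexp; simpl. now rewrite cos_2PI, sin_2PI, cos_0, sin_0. }
rewrite (RInt_const (V := R_CompleteNormedModule)) in H.
rewrite (RInt_ext _ (fun t => minus (Re (K (polar r2 t))) (Re (K (polar r1 t))))) in H
  by (intros t _; rewrite !E by lra; reflexivity).
rewrite (RInt_minus (V := R_CompleteNormedModule)) in H
  by (apply ex_circle_int; [lra|intros z Hz; apply HC; lra]).
unfold circle_int. unfold minus, plus, opp, scal in H; simpl in H. unfold mult in H; simpl in H.
lra.
Qed.

Lemma circle_int_continuous (K : C -> C) (r0 : R) :
  0 <= r0 -> (forall z, Cmod z <= r0 -> continuous K z) ->
  forall eps, 0 < eps -> exists del, 0 < del /\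
  forall r s, 0 <= r <= r0 -> 0 <= s <= r0 -> Rabs (r - s) < del ->
    Rabs (circle_int K r - circle_int K s) <= eps.
Proof.
intros Hr HK eps He. assert (Hpi := PI_RGT_0).
assert (He' : 0 < eps / (2 * PI)) by (apply Rdiv_lt_0_compat; lra).
destruct (uniform_continuity_2d (fun r t => Re (K (polar r t))) 0 r0 0 (2 * PI)) with
  (eps := mkposreal _ He') as [del Hdel].
- intros r t Hr' Ht. apply continuity_2d_pt_filterlim.
  apply (continuous_Re (fun z : R * R => K (polar (fst z) (snd z))) (r, t)).
  apply (continuous_comp (fun z : R * R => polar (fst z) (snd z)) K).
  + apply continuous_polar; [apply continuous_fst|apply continuous_snd].
  + apply HK. simpl. rewrite Cmod_polar; lra.
- exists del. split; [apply cond_pos|]. intros r s Hr' Hs Hrs.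
  unfold circle_int.
  assert (Er : ex_RInt (fun t => Re (K (polar r t))) 0 (2 * PI))
    by (apply ex_circle_int; [lra|intros; apply HK; lra]).
  assert (Es : ex_RInt (fun t => Re (K (polar s t))) 0 (2 * PI))
    by (apply ex_circle_int; [lra|intros; apply HK; lra]).
  apply Rle_trans with ((2 * PI - 0) * (eps / (2 * PI))); [|right; field; lra].
  apply (norm_RInt_le_const (V := R_NormedModule)
    (fun t => minus (Re (K (polar r t))) (Re (K (polar s t)))) 0 (2 * PI)); [lra| |].
  + intros t Ht. left. apply (Hdel s t r t); try assumption.
    replace (t - t) with 0 by ring. rewrite Rabs_R0. apply cond_pos.
  + apply (is_RInt_minus (V := R_NormedModule));
      now apply (RInt_correct (V := R_CompleteNormedModule)).
Qed.

(* Differentiability may fail at the centre and on one circle: there continuity suffices,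
   as the circle integral is continuous in the radius. *)
Lemma mean_value (K : C -> C) (a r : R) :
  0 < a < r -> (forall z, Cmod z <= r -> continuous K z) ->
  (forall z, 0 < Cmod z <= r -> Cmod z <> a -> exists l, cdiff K z l) ->
  circle_int K r = 2 * PI * Re (K 0%C).
Proof.
intros Ha HC HK.
assert (H0 : circle_int K 0 = 2 * PI * Re (K 0%C)).
{ unfold circle_int.
  rewrite (RInt_ext _ (fun _ => Re (K 0%C))).
  - rewrite (RInt_const (V := R_CompleteNormedModule)).
    unfold scal; simpl; unfold mult; simpl; ring.
  - intros t _. unfold polar. now rewrite !Rmult_0_l. }
rewrite <- H0. apply Rminus_diag_uniq. apply Rabs_eq_0, Rle_antisym; [|apply Rabs_pos].
apply le_epsilon. intros eps He. rewrite Rplus_0_l.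
destruct (circle_int_continuous K r ltac:(lra) HC (eps / 2) ltac:(lra)) as [del [Hdel Hc]].
(* The radii [a - e] and [a + e] around the exceptional circle are less than [del] apart, and so are
   [0] and [e]; the other two bounds keep [e <= a - e] and [a + e <= r]. Each of the two gaps costs
   [eps / 2]. *)
set (e := Rmin (del / 4) (Rmin (a / 2) ((r - a) / 2))).
assert (E0 : 0 < e) by (repeat apply Rmin_pos; lra).
assert (E1 : e <= del / 4) by apply Rmin_l.
assert (E2 : e <= a / 2) by (eapply Rle_trans; [apply Rmin_r|apply Rmin_l]).
assert (E3 : e <= (r - a) / 2) by (eapply Rle_trans; [apply Rmin_r|apply Rmin_r]).
assert (A1 : circle_int K (a + e) = circle_int K r)
  by (apply circle_int_annulus; [lra|intros z Hz; apply HK; lra]).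
assert (A2 : circle_int K e = circle_int K (a - e))
  by (apply circle_int_annulus; [lra|intros z Hz; apply HK; lra]).
assert (B1 := Hc (a + e) (a - e) ltac:(lra) ltac:(lra) ltac:(rewrite Rabs_pos_eq; lra)).
assert (B2 := Hc e 0 ltac:(lra) ltac:(lra) ltac:(rewrite Rabs_pos_eq; lra)).
rewrite <- A1. rewrite A2 in B2.
apply Rabs_le_between in B1. apply Rabs_le_between in B2. apply Rabs_le. lra.
Qed.

(** On the circle [r ^ 2 = z * Cconj z], so the second denominator is [z * Cconj (z - a)]. The left
    side is holomorphic in [z] apart from the pole at [a], and becomes real and positive on the
    circle. *)
Lemma poisson_kernel (a z : C) (r : R) :
  Cmod a < r -> Cmod z = r ->
  (z * (/ (z - a) + Cconj a / (RtoC (r ^ 2) - Cconj a * z)))%C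
  = RtoC ((r ^ 2 - Cmod a ^ 2) / Cmod (z - a) ^ 2).
Proof.
intros Ha Hz.
assert (Hr : 0 < r) by (generalize (Cmod_ge_0 a); lra).
assert (Hz0 : z <> 0%C) by (apply Cmod_gt_0; lra).
assert (Hza : (z - a)%C <> 0%C) by (intros E; apply C_minus_eq_0 in E; subst a; lra).
assert (Hc : (Cconj z - Cconj a)%C <> 0%C).
{ apply Cmod_gt_0.
  replace (Cconj z - Cconj a)%C with (Cconj (z - a))
    by (apply injective_projections; simpl; ring).
  rewrite Cmod_conj. now apply Cmod_gt_0. }
rewrite RtoC_div, RtoC_minus by (apply pow_nonzero; apply Cmod_gt_0 in Hza; lra).
replace (RtoC (Cmod (z - a) ^ 2)) with ((z - a) * (Cconj z - Cconj a))%C.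
2: { rewrite Cmod2_conj. f_equal. apply injective_projections; simpl; ring. }
rewrite <- Hz, !Cmod2_conj.
field. repeat split; trivial.
replace (z * Cconj z - Cconj a * z)%C with (z * (Cconj z - Cconj a))%C by ring.
now apply Cmult_neq_0.
Qed.

(** Caratheodory's slope equals the difference quotient only near [a]; this version does so at every
    [z <> a]. It supplies [f z / z] at the origin, and it removes the pole of the Poisson kernel. *)
Lemma cdiff_quotient (f : C -> C) (a l : C) : cdiff f a l ->
  exists D : C -> C, continuous D a /\ D a = l /\ forall z, z <> a -> D z = ((f z - f a) / (z - a))%C.
Proof.
intros [h [Hh [Hl He]]].
exists (fun z => if Ceq_dec z a then h a else ((f z - f a) / (z - a))%C). split.
- apply (continuous_ext_loc _ h); [|exact Hh].
  revert He. apply filter_imp. intros w Hw.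
  destruct (Ceq_dec w a) as [->|N]; [reflexivity|].
  rewrite Hw. cfield. intros E. now apply N, C_minus_eq_0.
- split; [now destruct (Ceq_dec a a)|]. intros z Hz. now destruct (Ceq_dec z a).
Qed.

Lemma locally_neq (z a : C) : z <> a -> locally z (fun w : C => w <> a).
Proof.
intros H.
generalize (continuous_neq_0 (fun w : C => w - a)%C z
  ltac:(apply continuous_Cminus; [apply continuous_id|apply continuous_const])
  ltac:(intros E; now apply H, C_minus_eq_0)).
apply filter_imp. intros w Hw ->. apply Hw. cring.
Qed.

(* Applies the mean value property to [K z = Cconj m * (phi z - z m) * P z / z], with [P] the
   Poisson kernel at [a] and [m = phi a / a]; if [|m| > 1 / rho] then [Re K < 0] on a circle
   while [K 0 = 0]. No differentiability of [phi] at [0] is needed. *)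
Lemma schwarz (phi : C -> C) (rho : R) (a : C) :
  phi 0%C = 0%C -> continuous phi (RtoC 0) ->
  (forall z, 0 < Cmod z < rho -> (exists l, cdiff phi z l) /\ Cmod (phi z) <= 1) ->
  0 < Cmod a < rho -> Cmod (phi a) <= Cmod a / rho.
Proof.
intros H0 Hc0 Hphi Ha. apply Rnot_lt_le. intros Hlt.
assert (Ha0 : a <> 0%C) by (apply Cmod_gt_0; lra).
set (m := (phi a / a)%C).
assert (Hm : Cmod m = Cmod (phi a) / Cmod a) by (unfold m; now apply Cmod_div).
assert (Hmr : / rho < Cmod m).
{ rewrite Hm. apply Rlt_div_r; [lra|]. now rewrite Rmult_comm. }
assert (Hinv : 0 < / rho) by (apply Rinv_0_lt_compat; lra).
assert (Hmr' : / Cmod m < rho)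
  by (rewrite <- (Rinv_inv rho); apply Rinv_lt_contravar; [apply Rmult_lt_0_compat; lra|lra]).
(* The radius must enclose [a], stay below [rho], and already satisfy [/ r < Cmod m]. *)
assert (Hr : exists r, Cmod a < r < rho /\ / Cmod m < r).
{ exists ((Rmax (Cmod a) (/ Cmod m) + rho) / 2).
  assert (A1 := Rmax_l (Cmod a) (/ Cmod m)). assert (A2 := Rmax_r (Cmod a) (/ Cmod m)).
  assert (A3 := Rmax_lub_lt _ _ _ (proj2 Ha) Hmr'). lra. }
destruct Hr as [r [Har Hmr2]].
assert (Hmr3 : / r < Cmod m)
  by (rewrite <- (Rinv_inv (Cmod m)); apply Rinv_lt_contravar;
      [apply Rmult_lt_0_compat; [apply Rinv_0_lt_compat|]|]; lra).
set (psi := fun z => (phi z - z * m)%C).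
assert (Hpa : psi a = 0%C) by (unfold psi, m; field; exact Ha0).
assert (Dpsi : forall z, 0 < Cmod z < rho -> exists l, cdiff psi z l).
{ intros z Hz. destruct (Hphi z Hz) as [[l Hl] _]. eexists.
  apply cdiff_minus; [exact Hl|]. apply cdiff_mult; [apply cdiff_id|apply cdiff_const]. }
destruct (Dpsi a Ha) as [l Hl]. destruct (cdiff_quotient psi a l Hl) as [D [CD [_ HD]]].
set (q := fun z => (Cconj a / (RtoC (r ^ 2) - Cconj a * z))%C).
assert (Hq : forall z, Cmod z <= r -> (RtoC (r ^ 2) - Cconj a * z)%C <> 0%C).
{ intros z Hz E. apply C_minus_eq_0 in E.
  assert (F : Cmod (RtoC (r ^ 2)) = Cmod (Cconj a * z)) by now rewrite E.
  rewrite Cmod_R, Cmod_mult, Cmod_conj, Rabs_pos_eq in F by apply pow2_ge_0.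
  assert (Hz0 := Cmod_ge_0 z). nra. }
assert (Dq : forall z, Cmod z <= r -> exists l, cdiff q z l).
{ intros z Hz. eexists. apply cdiff_div; [apply cdiff_const| |now apply Hq].
  apply cdiff_minus; [apply cdiff_const|]. apply cdiff_mult; [apply cdiff_const|apply cdiff_id]. }
(* The kernel divided by [z] is [/ (z - a) + q z]. Since [psi a = 0], the product of [psi] with the
   first term extends continuously through [a], as [D]. *)
set (K := fun z => (Cconj m * (D z + psi z * q z))%C).
assert (HDK : forall z, z <> a -> D z = (psi z / (z - a))%C).
{ intros z Hz. rewrite HD by exact Hz. rewrite Hpa. f_equal. ring. }
assert (Cq : forall z, Cmod z <= r -> continuous q z).
{ intros z Hz. destruct (Dq z Hz) as [k Hk]. now apply cdiff_continuous in Hk. }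
assert (Cpsi : forall z, Cmod z <= r -> continuous psi z).
{ intros z Hz. destruct (Ceq_dec z 0) as [->|N].
  - apply continuous_Cminus; [exact Hc0|].
    apply continuous_Cmult; [apply continuous_id|apply continuous_const].
  - apply Cmod_gt_0 in N. destruct (Dpsi z ltac:(lra)) as [k Hk]. now apply cdiff_continuous in Hk. }
assert (CK : forall z, Cmod z <= r -> continuous K z).
{ intros z Hz. apply continuous_Cmult; [apply continuous_const|].
  apply continuous_Cplus; [|apply continuous_Cmult; auto].
  destruct (Ceq_dec z a) as [->|N]; [exact CD|].
  apply (continuous_ext_loc _ (fun w => psi w / (w - a))%C).
  - generalize (locally_neq z a N). apply filter_imp. intros w Hw. symmetry; now apply HDK.
  - apply continuous_Cdiv; [now apply Cpsi| |intros E; now apply N, C_minus_eq_0].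
    apply continuous_Cminus; [apply continuous_id|apply continuous_const]. }
assert (Kint : circle_int K r = 2 * PI * Re (K 0%C)).
(* At [a] only continuity of [K] is at hand, so the circle through [a] serves as the exceptional
   one. *)
{ apply (mean_value K (Cmod a)); [lra|exact CK|].
  intros z Hz Hza. assert (N : z <> a) by (intros ->; now apply Hza).
    destruct (Dpsi z ltac:(lra)) as [k Hk]. destruct (Dq z (proj2 Hz)) as [k' Hk'].
    eexists. apply cdiff_scal. apply cdiff_plus; [|apply cdiff_mult; eassumption].
    apply (cdiff_ext_loc (fun w => psi w / (w - a))%C).
    + generalize (locally_neq z a N). apply filter_imp. intros w Hw. symmetry; now apply HDK.
    + apply cdiff_div; [exact Hk| |intros E; now apply N, C_minus_eq_0].
      apply cdiff_minus; [apply cdiff_id|apply cdiff_const]. }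
assert (K0 : K 0%C = 0%C).
{ unfold K. rewrite HDK by (intros E; now apply Ha0). unfold psi. rewrite H0.
  unfold Cdiv. ring. }
rewrite K0 in Kint. simpl in Kint. rewrite Rmult_0_r in Kint.
assert (Hpi := PI_RGT_0).
(* On the circle [K z = p * (Cconj m * (phi z / z) - Cmod m ^ 2)] with [p > 0], and
   [Cmod (phi z / z) <= / r < Cmod m]. *)
assert (Neg : forall z, Cmod z = r -> Re (K z) < 0).
{ intros z Hz. assert (N : z <> a) by (intros ->; lra).
  assert (Hz0 : z <> 0%C) by (apply Cmod_gt_0; lra).
  assert (Hza : (z - a)%C <> 0%C) by (intros E; now apply N, C_minus_eq_0).
  assert (P := poisson_kernel a z r (proj1 Har) Hz).
  set (p := (r ^ 2 - Cmod a ^ 2) / Cmod (z - a) ^ 2) in P.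
  assert (Hp : 0 < p).
  { apply Rdiv_lt_0_compat; [generalize (Cmod_ge_0 a); nra|].
    apply pow_lt. now apply Cmod_gt_0. }
  assert (EK : K z = (RtoC p * (Cconj m * (phi z / z) - RtoC (Cmod m ^ 2)))%C).
  { rewrite <- P, Cmod2_conj. unfold K. rewrite HDK by exact N. unfold psi, q.
    assert (Hqz := Hq z ltac:(lra)). field. now repeat split. }
  assert (L : Re (Cconj m * (phi z / z))%C <= Cmod m * / r).
  { eapply Rle_trans; [apply Rle_abs|]. eapply Rle_trans; [apply re_le_Cmod|].
    rewrite Cmod_mult, Cmod_conj, Cmod_div, Hz by exact Hz0.
    apply Rmult_le_compat_l; [apply Cmod_ge_0|].
    unfold Rdiv. rewrite <- (Rmult_1_l (/ r)) at 2. apply Rmult_le_compat_r.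
    - left; apply Rinv_0_lt_compat; lra.
    - apply Hphi; lra. }
  rewrite EK. revert L. generalize (Cconj m * (phi z / z))%C. intros w L.
  replace (Re (RtoC p * (w - RtoC (Cmod m ^ 2)))%C) with (p * (Re w - Cmod m ^ 2))
    by (unfold Re; simpl; ring).
  assert (Hm0 : 0 < / r) by (apply Rinv_0_lt_compat; lra).
  assert (Cmod m * / r < Cmod m ^ 2) by nra.
  assert (0 < p * (Cmod m ^ 2 - Re w)) by (apply Rmult_lt_0_compat; lra). lra. }
assert (Pos : 0 < RInt (fun t => - Re (K (polar r t))) 0 (2 * PI)).
{ apply RInt_gt_0; [lra| |].
  - intros t _. generalize (Neg (polar r t) (Cmod_polar r t ltac:(lra))). lra.
  - intros t _. apply (continuous_opp (V := R_NormedModule)).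
    apply continuous_Re. apply (continuous_comp (fun t => polar r t) K).
    + apply continuous_polar; [apply continuous_const|apply continuous_id].
    + apply CK. rewrite Cmod_polar; lra. }
assert (E : RInt (fun t => - Re (K (polar r t))) 0 (2 * PI) = - circle_int K r).
{ apply (RInt_opp (V := R_CompleteNormedModule) (fun t => Re (K (polar r t)))).
  apply ex_circle_int; [lra|]. intros z Hz; apply CK; lra. }
lra.
Qed.

(** * Powers of functions with values in a sector *)

Definition Cpow_R (w : C) (y : R) : C := Cexp (RtoC y * Clog w)%C.

Definition in_sector (A1 A2 : R) (w : C) : Prop :=
  0 < Re w /\ - A1 < Im (Clog w) < A2.

(** The power opens the sector to the half-plane of arguments within [PI / 2] of [th / 2]. Its
    boundary is the perpendicular bisector of [1] and [- polar 1 th], so its points are those nearer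
    to [1]. Squared out, the inequality says [cos s + cos (s - th) > 0], a sum that factors as
    [2 cos (th / 2) cos (s - th / 2)]. *)
Lemma sector_half_plane (a1 a2 : R) (w : C) :
  0 < a1 -> 0 < a2 -> in_sector (PI * a1 / 2) (PI * a2 / 2) w ->
  let g := Cpow_R w (/ ((a1 + a2) / 2)) in
  Cmod (g - 1) < Cmod (g + polar 1 (PI * ((a2 - a1) / (a2 + a1)))).
Proof.
intros H1 H2 [_ Ht] g. assert (Hpi := PI_RGT_0).
set (th := PI * ((a2 - a1) / (a2 + a1))).
set (s := / ((a1 + a2) / 2) * Im (Clog w)).
set (m := exp (/ ((a1 + a2) / 2) * Re (Clog w))).
assert (Hm : 0 < m) by apply exp_pos.
assert (Hg : g = (m * cos s, m * sin s)).
{ unfold g, Cpow_R, Cexp, m, s. destruct (Clog w) as [u v]. unfold Re, Im; simpl.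
  f_equal; f_equal; f_equal; ring. }
assert (Hb : 0 < / ((a1 + a2) / 2)) by (apply Rinv_0_lt_compat; lra).
assert (S1 : s < PI / 2 + th / 2).
{ replace (PI / 2 + th / 2) with (/ ((a1 + a2) / 2) * (PI * a2 / 2)) by (unfold th; field; lra).
  now apply Rmult_lt_compat_l. }
assert (S2 : - (PI / 2) + th / 2 < s).
{ replace (- (PI / 2) + th / 2) with (/ ((a1 + a2) / 2) * - (PI * a1 / 2))
    by (unfold th; field; lra).
  now apply Rmult_lt_compat_l. }
assert (T : - PI < th < PI).
{ unfold th. assert (-1 < (a2 - a1) / (a2 + a1) < 1); [|split; nra].
  split; [apply Rlt_div_r|apply Rlt_div_l]; lra. }
assert (Hpos : 0 < cos s + cos (s - th)).
{ rewrite form1.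
  assert (0 < cos ((s - (s - th)) / 2)) by (apply cos_gt_0; lra).
  assert (0 < cos ((s + (s - th)) / 2)) by (apply cos_gt_0; lra).
  assert (0 < cos ((s - (s - th)) / 2) * cos ((s + (s - th)) / 2))
    by now apply Rmult_lt_0_compat.
  lra. }
rewrite cos_minus in Hpos.
rewrite Hg. unfold Cmod. apply sqrt_lt_1_alt. split.
- apply Rplus_le_le_0_compat; apply pow2_ge_0.
- unfold polar; simpl. clearbody s m th.
  assert (E1 := sin2_cos2 s). assert (E2 := sin2_cos2 th). unfold Rsqr in E1, E2. nra.
Qed.

Lemma continuous_Cpow_R {T : UniformSpace} (F : T -> C) (y : R) (x : T) :
  continuous F x -> 0 < Re (F x) -> continuous (fun t => Cpow_R (F t) y) x.
Proof.
intros HF H. apply continuous_Cexp, continuous_Cmult; [apply continuous_const|].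
now apply continuous_Clog.
Qed.

Lemma sector_schwarz (Q : C -> C) (rho a1 a2 : R) (a : C) :
  0 < a1 -> 0 < a2 ->
  Q 0%C = 1%C -> continuous Q (RtoC 0) ->
  (forall z, 0 < Cmod z < rho ->
     (exists l, cdiff Q z l) /\ in_sector (PI * a1 / 2) (PI * a2 / 2) (Q z)) ->
  0 < Cmod a < rho ->
  let g := Cpow_R (Q a) (/ ((a1 + a2) / 2)) in
  Cmod (g - 1) <= Cmod a / rho * Cmod (g + polar 1 (PI * ((a2 - a1) / (a2 + a1)))).
Proof.
intros H1 H2 Q0 CQ HQ Ha.
set (b := / ((a1 + a2) / 2)). set (k := polar 1 (PI * ((a2 - a1) / (a2 + a1)))).
intros g.
set (phi := fun z => ((Cpow_R (Q z) b - 1) / (Cpow_R (Q z) b + k))%C).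
assert (Hpi := PI_RGT_0).
assert (Hlog1 : Clog 1 = 0%C).
{ rewrite <- Cexp_0. apply Clog_Cexp. simpl. lra. }
assert (HS : forall w, in_sector (PI * a1 / 2) (PI * a2 / 2) w ->
  Cmod (Cpow_R w b - 1) < Cmod (Cpow_R w b + k))
  by (intros w Hw; exact (sector_half_plane a1 a2 w H1 H2 Hw)).
assert (Hne : forall w, in_sector (PI * a1 / 2) (PI * a2 / 2) w -> (Cpow_R w b + k)%C <> 0%C).
{ intros w Hw. apply Cmod_gt_0. eapply Rle_lt_trans; [apply Cmod_ge_0|apply (HS w Hw)]. }
assert (I1 : in_sector (PI * a1 / 2) (PI * a2 / 2) 1).
{ split; [simpl; lra|]. rewrite Hlog1. simpl. split; nra. }
assert (Hp1 : Cpow_R 1 b = 1%C)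
  by (unfold Cpow_R; rewrite Hlog1, Cmult_0_r; apply Cexp_0).
assert (Hsch : Cmod (phi a) <= Cmod a / rho).
{ apply schwarz; [| | |exact Ha].
  - unfold phi. rewrite Q0, Hp1. unfold Cdiv. ring.
  - assert (CP : continuous (fun z => Cpow_R (Q z) b) (RtoC 0))
      by (apply continuous_Cpow_R; [exact CQ|rewrite Q0; simpl; lra]).
    apply continuous_Cdiv.
    + apply continuous_Cminus; [exact CP|apply continuous_const].
    + apply continuous_Cplus; [exact CP|apply continuous_const].
    + rewrite Q0. now apply Hne.
  - intros z Hz. destruct (HQ z Hz) as [[l Hl] Hs]. split.
    + assert (DP : exists l, cdiff (fun z => Cpow_R (Q z) b) z l).
      { eexists. apply (cdiff_comp Cexp); [|apply cdiff_Cexp].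
        apply cdiff_scal. apply (cdiff_comp Clog); [exact Hl|]. apply cdiff_Clog, Hs. }
      destruct DP as [l' Hl']. eexists. apply cdiff_div.
      * apply cdiff_minus; [exact Hl'|apply cdiff_const].
      * apply cdiff_plus; [exact Hl'|apply cdiff_const].
      * now apply Hne.
    + unfold phi. assert (N := Hne _ Hs). rewrite Cmod_div by exact N.
      apply Cmod_gt_0 in N. apply Rle_div_l; [exact N|]. generalize (HS _ Hs). lra. }
assert (N := Hne _ (proj2 (HQ a Ha))).
unfold phi in Hsch. rewrite Cmod_div in Hsch by exact N.
apply Cmod_gt_0 in N. exact (proj1 (Rle_div_l _ _ _ N) Hsch).
Qed.

(** * Rotation quotients *)

Lemma polar_decomposition (z : C) : exists t, 0 <= t <= 2 * PI /\ z = polar (Cmod z) t.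
Proof.
assert (Hpi := PI_RGT_0).
destruct (Ceq_dec z 0) as [->|N].
{ exists 0. split; [lra|]. rewrite Cmod_0. unfold polar. now rewrite !Rmult_0_l. }
apply Cmod_gt_0 in N.
set (x := Re z / Cmod z).
assert (Hx : -1 <= x <= 1).
{ assert (A := re_le_Cmod z). apply Rabs_le_between in A.
  unfold x; split; [apply Rle_div_r|apply Rle_div_l]; lra. }
assert (E : Cmod z ^ 2 = Re z ^ 2 + Im z ^ 2) by apply Cmod2_alt.
assert (B := acos_bound x).
assert (HR : Cmod z * x = Re z) by (unfold x; field; lra).
assert (HI : Cmod z * sqrt (1 - x²) = Rabs (Im z)).
{ rewrite <- (sqrt_pow2 (Cmod z)) at 1 by lra. rewrite <- sqrt_mult_alt by apply pow2_ge_0.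
  rewrite <- sqrt_Rsqr_abs. f_equal. unfold Rsqr.
  replace (Cmod z ^ 2 * (1 - x * x)) with (Cmod z ^ 2 - (Cmod z * x) ^ 2) by ring.
  rewrite HR, E. ring. }
destruct (Rle_dec 0 (Im z)) as [L|L].
- exists (acos x). split; [lra|]. unfold polar. rewrite cos_acos, sin_acos by exact Hx.
  rewrite HR, HI, Rabs_pos_eq by exact L. now destruct z.
- exists (2 * PI - acos x). split; [lra|]. unfold polar.
  rewrite cos_minus, sin_minus, cos_2PI, sin_2PI, cos_acos, sin_acos by exact Hx.
  replace (Cmod z * (1 * x + 0 * sqrt (1 - x²))) with (Cmod z * x) by ring.
  replace (Cmod z * (0 * x - 1 * sqrt (1 - x²))) with (- (Cmod z * sqrt (1 - x²))) by ring.
  rewrite HR, HI, Rabs_left by lra. rewrite Ropp_involutive. now destruct z.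
Qed.

Lemma polar_mult (r s t u : R) : (polar r t * polar s u)%C = polar (r * s) (t + u).
Proof.
unfold polar. rewrite cos_plus, sin_plus.
apply injective_projections; simpl; ring.
Qed.

(** For unit vectors [2 * Re (A * Cconj B) = 2 - Cmod (A - B) ^ 2], and coordinate gaps below [1]
    keep the square below [2]. *)
Lemma Re_mult_conj_pos (A B : C) :
  Cmod A = 1 -> Cmod B = 1 ->
  Rabs (Re A - Re B) < 1 -> Rabs (Im A - Im B) < 1 -> 0 < Re (A * Cconj B)%C.
Proof.
intros HA HB H1 H2.
assert (EA := Cmod2_alt A). assert (EB := Cmod2_alt B). rewrite HA in EA. rewrite HB in EB.
apply Rabs_lt_between in H1. apply Rabs_lt_between in H2.
destruct A as [x y], B as [u v]. unfold Re, Im in *. simpl in *. nra.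
Qed.

(* Uniform continuity of the direction [w h(w) / |w h(w)|], in polar coordinates. *)
Lemma small_rotation_ratio (h : C -> C) (rho : R) :
  0 < rho ->
  (forall z, Cmod z <= rho -> continuous h z /\ h z <> 0%C) ->
  exists del, 0 < del /\ forall d z, 0 <= d < del -> Cmod z <= rho ->
    0 < Re (polar 1 d * (h (z * polar 1 d) / h z))%C.
Proof.
intros Hr Hh. assert (Hpi := PI_RGT_0).
set (F := fun z : R * R => (polar 1 (snd z) * (h (polar (fst z) (snd z))
  / RtoC (Cmod (h (polar (fst z) (snd z))))))%C).
assert (Hh' : forall r t, 0 <= r <= rho -> continuous h (polar r t) /\ h (polar r t) <> 0%C)
  by (intros r t Hrt; apply Hh; rewrite Cmod_polar; lra).
assert (HF1 : forall r t, 0 <= r <= rho -> Cmod (F (r, t)) = 1).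
{ intros r t Hrt. destruct (Hh' r t Hrt) as [_ N]. apply Cmod_gt_0 in N as P.
  unfold F; simpl fst; simpl snd.
  rewrite Cmod_mult, Cmod_polar, Cmod_div, Cmod_R, Rabs_pos_eq; try lra.
  - field. lra.
  - intros E. apply RtoC_inj in E. lra. }
assert (CF : forall r t, 0 <= r <= rho -> continuous F (r, t)).
{ intros r t Hrt. destruct (Hh' r t Hrt) as [Hc N].
  assert (Ch : continuous (fun z : R * R => h (polar (fst z) (snd z))) (r, t)).
  { apply (continuous_comp (fun z : R * R => polar (fst z) (snd z)) h); [|exact Hc].
    apply continuous_polar; [apply continuous_fst|apply continuous_snd]. }
  apply continuous_Cmult.
  - apply continuous_polar; [apply continuous_const|apply continuous_snd].
  - apply continuous_Cdiv; [exact Ch| |].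
    + apply continuous_C_mk; [|apply continuous_const]. now apply continuous_Cmod.
    + intros E. apply RtoC_inj in E. now apply N, Cmod_eq_0. }
(* The angle interval is lengthened by [1] so that it contains [t + d] for [t <= 2 * PI] and
   [d < 1]; hence the [1] in the minimum chosen for [del]. *)
assert (U : forall G : C -> R, (forall z, continuous F z -> continuous (fun t => G (F t)) z) ->
  exists del : posreal, forall r t u, 0 <= r <= rho -> 0 <= t <= 2 * PI + 1 ->
    0 <= u <= 2 * PI + 1 -> Rabs (u - t) < del -> Rabs (G (F (r, u)) - G (F (r, t))) < 1).
{ intros G HG.
  destruct (uniform_continuity_2d (fun r t => G (F (r, t))) 0 rho 0 (2 * PI + 1)) with
    (eps := mkposreal 1 Rlt_0_1) as [del Hd].
  - intros r t Hr' Ht. apply continuity_2d_pt_filterlim.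
    change (continuous (fun z : R * R => G (F (fst z, snd z))) (r, t)).
    apply (continuous_ext (fun z => G (F z))); [now intros [? ?]|].
    apply HG. now apply CF.
  - exists del. intros r t u Hr' Ht Hu Hut. apply (Hd r t r u); try assumption.
    rewrite Rminus_diag, Rabs_R0. apply cond_pos. }
destruct (U Re) as [d1 Hd1]; [intros z; apply continuous_Re|].
destruct (U Im) as [d2 Hd2]; [intros z; apply continuous_Im|].
exists (Rmin 1 (Rmin d1 d2)). split; [repeat apply Rmin_pos; try apply cond_pos; lra|].
intros d z Hd Hz.
assert (D1 : Rmin 1 (Rmin d1 d2) <= 1) by apply Rmin_l.
assert (D2 : Rmin 1 (Rmin d1 d2) <= d1) by (eapply Rle_trans; [apply Rmin_r|apply Rmin_l]).
assert (D3 : Rmin 1 (Rmin d1 d2) <= d2) by (eapply Rle_trans; [apply Rmin_r|apply Rmin_r]).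
destruct (polar_decomposition z) as [t [Ht E]].
set (r := Cmod z) in *. assert (Hr' : 0 <= r <= rho) by (split; [apply Cmod_ge_0|exact Hz]).
assert (Hdt : Rabs (t + d - t) = d) by (replace (t + d - t) with d by ring; apply Rabs_pos_eq; lra).
assert (P : 0 < Re (F (r, (t + d)%R) * Cconj (F (r, t)))%C).
{ apply Re_mult_conj_pos; try apply HF1; trivial.
  - apply Hd1; try assumption; lra.
  - apply Hd2; try assumption; lra. }
destruct (Hh' r t Hr') as [_ N1]. destruct (Hh' r (t + d) Hr') as [_ N2].
assert (Ez : (z * polar 1 d)%C = polar r (t + d)) by (rewrite E, polar_mult; f_equal; ring).
rewrite Ez, E. revert P. unfold F; simpl fst; simpl snd.
replace (polar 1 (t + d)) with (polar 1 t * polar 1 d)%C by (rewrite polar_mult; f_equal; ring).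
set (A := h (polar r (t + d))) in *. set (B := h (polar r t)) in *.
apply Cmod_gt_0 in N1 as P1. apply Cmod_gt_0 in N2 as P2.
assert (EB : (B * Cconj B)%C = (RtoC (Cmod B) * RtoC (Cmod B))%C)
  by (rewrite <- Cmod2_conj, <- RtoC_mult; f_equal; ring).
assert (Et : (polar 1 t * Cconj (polar 1 t))%C = 1%C)
  by (rewrite <- Cmod2_conj, Cmod_polar by lra; f_equal; ring).
assert (NB : RtoC (Cmod B) <> 0%C) by (intros H; apply RtoC_inj in H; lra).
assert (NA : RtoC (Cmod A) <> 0%C) by (intros H; apply RtoC_inj in H; lra).
assert (EC : Cconj (polar 1 t * (B / RtoC (Cmod B)))
  = (Cconj (polar 1 t) * (Cconj B / RtoC (Cmod B)))%C).
{ rewrite Cmult_conj, Cdiv_conj by exact NB. f_equal. f_equal.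
  apply injective_projections; simpl; ring. }
rewrite EC.
(* [F (r, t + d) * Cconj (F (r, t))] is the desired ratio times the positive number
   [Cmod B / Cmod A]. *)
replace (polar 1 t * polar 1 d * (A / RtoC (Cmod A)) * (Cconj (polar 1 t) * (Cconj B / RtoC (Cmod B))))%C
  with (RtoC (Cmod B / Cmod A) * (polar 1 d * (A / B)))%C.
- intros P. set (w := (polar 1 d * (A / B))%C) in *.
  replace (Re (RtoC (Cmod B / Cmod A) * w)%C) with (Cmod B / Cmod A * Re w) in P
    by (unfold Re; simpl; ring).
  assert (0 < Cmod B / Cmod A) by now apply Rdiv_lt_0_compat.
  nra.
- rewrite RtoC_div by lra.
  replace (polar 1 t * polar 1 d * (A / RtoC (Cmod A)) * (Cconj (polar 1 t) * (Cconj B / RtoC (Cmod B))))%C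
    with ((polar 1 t * Cconj (polar 1 t)) * (B * Cconj B)
      * (polar 1 d * A / (RtoC (Cmod A) * B * RtoC (Cmod B))))%C
    by (field; repeat split; assumption).
  rewrite Et, EB. field. repeat split; assumption.
Qed.

Lemma Cexp_Ci (t : R) : Cexp (Ci * RtoC t) = polar 1 t.
Proof.
unfold Cexp, polar; simpl. replace (0 * t - 1 * 0) with 0 by ring.
rewrite exp_0. apply injective_projections; simpl; f_equal; f_equal; ring.
Qed.

(** The angle is a complex variable, so that [cdiff] applies in it: its derivative at real angles
    feeds the mean value theorem, and its slope at [0] gives the limit [d -> 0]. *)
Definition log_rotation (f : C -> C) (z zeta : C) : C :=
  Clog (f (z * Cexp (Ci * zeta)) / f z)%C.

(** The derivative is [Ci] times the value of [z f' / f] at the rotated point, so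
    [log_rotation f z d / (Ci * d)] acts as an average of that quotient over an arc. *)
Lemma cdiff_log_rotation (f : C -> C) (z l : C) (t : R) :
  cdiff f (z * polar 1 t)%C l -> f z <> 0%C ->
  0 < Re (f (z * polar 1 t) / f z)%C ->
  cdiff (log_rotation f z) t (Ci * (z * polar 1 t * l / f (z * polar 1 t)))%C.
Proof.
intros Hf Hz Hp.
assert (N : f (z * polar 1 t)%C <> 0%C).
{ intros E. rewrite E in Hp. unfold Cdiv in Hp. rewrite Cmult_0_l in Hp. simpl in Hp. lra. }
eapply cdiff_eq.
- apply (cdiff_comp Clog (fun w => f (z * Cexp (Ci * w)) / f z)%C).
  + apply (cdiff_mult (fun w => f (z * Cexp (Ci * w))%C) (fun _ => (/ f z)%C)); [|apply cdiff_const].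
    apply (cdiff_comp f (fun w => z * Cexp (Ci * w))%C).
    * apply cdiff_scal. apply (cdiff_comp Cexp (fun w => Ci * w)%C); [|apply cdiff_Cexp].
      apply cdiff_scal, cdiff_id.
    * rewrite Cexp_Ci. exact Hf.
  + cbv beta. rewrite Cexp_Ci. apply cdiff_Clog. exact Hp.
- cbv beta. rewrite Cexp_Ci. field. split; assumption.
Qed.

(* Mean value theorem for [Re (k * _)] along the arc from [z] to [z e^(id)]. *)
Lemma log_rotation_half_plane (f f' : C -> C) (z k : C) (d : R) :
  0 < d -> f z <> 0%C ->
  (forall t, 0 <= t <= d -> cdiff f (z * polar 1 t)%C (f' (z * polar 1 t)%C) /\
     0 < Re (f (z * polar 1 t) / f z)%C /\
     0 < Re (k * (z * polar 1 t * f' (z * polar 1 t) / f (z * polar 1 t)))%C) ->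
  0 < Re (k * (log_rotation f z d / (Ci * d)))%C.
Proof.
intros Hd Hz H.
assert (HC : Ci <> 0%C) by (intros E; injection E; lra).
set (F := fun w => (k / Ci * log_rotation f z w)%C).
assert (DF : forall t, 0 <= t <= d -> is_derive (fun x : R => Re (F (RtoC x))) t
  (Re (k * (z * polar 1 t * f' (z * polar 1 t) / f (z * polar 1 t)))%C)).
{ intros t Ht. destruct (H t Ht) as [A [B D]]. apply cdiff_Re_is_derive.
  eapply cdiff_eq; [apply cdiff_scal, cdiff_log_rotation; eassumption|].
  field. split; [|exact HC].
  intros E. rewrite E in B. unfold Cdiv in B. rewrite Cmult_0_l in B. simpl in B. lra. }
destruct (MVT_gen (fun x : R => Re (F (RtoC x))) 0 d
  (fun t => Re (k * (z * polar 1 t * f' (z * polar 1 t) / f (z * polar 1 t)))%C))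
  as [c [Hc E]].
- intros x Hx. rewrite Rmin_left, Rmax_right in Hx by lra. apply DF. lra.
- intros x Hx. rewrite Rmin_left, Rmax_right in Hx by lra.
  apply continuity_pt_filterlim. apply (ex_derive_continuous (V := R_NormedModule)).
  eexists. now apply DF.
- rewrite Rmin_left, Rmax_right in Hc by lra.
  assert (F0 : F (RtoC 0) = 0%C).
  { unfold F, log_rotation. rewrite Cexp_Ci.
    replace (polar 1 0) with (RtoC 1)
      by (unfold polar; rewrite cos_0, sin_0; apply injective_projections; simpl; ring).
    rewrite Cmult_1_r. replace (f z / f z)%C with (RtoC 1) by (field; exact Hz).
    rewrite <- Cexp_0, Clog_Cexp; [ring|]. simpl. generalize PI_RGT_0; lra. }
  rewrite F0 in E. change (Re (RtoC 0)) with 0 in E.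
  destruct (H c Hc) as [_ [_ P]].
  assert (ED : Re (k * (log_rotation f z d / (Ci * d)))%C = Re (F d) / d).
  { replace (k * (log_rotation f z d / (Ci * d)))%C with (RtoC (/ d) * F d)%C.
    - unfold Re; simpl. field. lra.
    - unfold F. rewrite RtoC_inv by lra. field.
      split; [|exact HC]. intros E'. apply RtoC_inj in E'. lra. }
  rewrite ED. apply Rdiv_lt_0_compat; [|exact Hd]. nra.
Qed.

(** * Sectors as intersections of half-planes *)

Lemma Re_mult_polar (k w : C) (t : R) :
  Re (k * (RtoC (Cmod w) * (cos t, sin t)))%C = Cmod w * (Re k * cos t - Im k * sin t).
Proof. unfold Re, Im; simpl. ring. Qed.

(** The two multipliers are [-i e^(i A1)] and [i e^(-i A2)]; at argument [t] they produce
    [sin (A1 + t)] and [sin (A2 - t)], one for each edge of the sector. Real-linear conditions of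
    this kind pass through the mean value theorem, unlike a bound on an argument. *)
Lemma arg_between_sector_functionals (w : C) (A1 A2 : R) :
  0 < A1 <= PI / 2 -> 0 < A2 <= PI / 2 -> arg_between w (- A1) A2 ->
  0 < Re w /\ 0 < Re ((sin A1, (- cos A1)%R) * w)%C /\ 0 < Re ((sin A2, cos A2) * w)%C.
Proof.
intros H1 H2 [t [[Hw [_ E]] Ht]]. apply Cmod_gt_0 in Hw.
rewrite E at 1 2 3.
replace (Re (RtoC (Cmod w) * (cos t, sin t))%C) with (Cmod w * cos t) by (unfold Re; simpl; ring).
rewrite !Re_mult_polar.
split; [|split]; apply Rmult_lt_0_compat; trivial; unfold Re, Im; simpl.
- apply cos_gt_0; lra.
- replace (sin A1 * cos t - - cos A1 * sin t) with (sin (A1 + t)) by (rewrite sin_plus; ring).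
  apply sin_gt_0; lra.
- replace (sin A2 * cos t - cos A2 * sin t) with (sin (A2 - t)) by (rewrite sin_minus; ring).
  apply sin_gt_0; lra.
Qed.

Lemma Clog_polar (w : C) : 0 < Re w ->
  w = (RtoC (Cmod w) * (cos (Im (Clog w)), sin (Im (Clog w))))%C.
Proof.
intros H. rewrite <- (Cexp_Clog w H) at 1. unfold Cexp.
replace (exp (Re (Clog w))) with (Cmod w).
- apply injective_projections; simpl; ring.
- simpl. rewrite exp_ln; [reflexivity|]. now apply Cmod_gt_0, Re_pos_neq_0.
Qed.

(** [0 < Re w] confines the argument [t] to [(- PI / 2, PI / 2)], so [A1 + t] and [A2 - t] exceed
    [- PI], where a positive sine forces a positive angle. *)
Lemma sector_functionals_in_sector (w : C) (A1 A2 : R) :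
  0 < A1 <= PI / 2 -> 0 < A2 <= PI / 2 ->
  0 < Re w -> 0 < Re ((sin A1, (- cos A1)%R) * w)%C -> 0 < Re ((sin A2, cos A2) * w)%C ->
  in_sector A1 A2 w.
Proof.
intros H1 H2 H3 P1 P2. split; [exact H3|].
assert (Hm := proj1 (Cmod_gt_0 w) (Re_pos_neq_0 w H3)).
assert (E := Clog_polar w H3).
assert (B : - PI / 2 < Im (Clog w) < PI / 2) by apply atan_bound.
revert E B. generalize (Im (Clog w)). intros t E B.
rewrite E in P1. rewrite E in P2. rewrite Re_mult_polar in P1, P2.
unfold Re, Im in P1, P2; simpl in P1, P2.
assert (S : forall x, 0 < Cmod w * sin x -> - PI < x -> 0 < x).
{ intros x Hx Hl. apply Rnot_le_lt. intros L.
  assert (sin x <= 0); [|nra].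
  rewrite <- (Ropp_involutive x), sin_neg.
  assert (0 <= sin (- x)) by (apply sin_ge_0; lra). lra. }
assert (T1 := S (A1 + t)). assert (T2 := S (A2 - t)).
rewrite sin_plus in T1. rewrite sin_minus in T2.
split.
- assert (0 < A1 + t); [|lra]. apply T1; [|lra]. nra.
- assert (0 < A2 - t); [|lra]. apply T2; [|lra]. nra.
Qed.

Lemma arg_between_in_sector (w : C) (A1 A2 : R) :
  0 < A1 <= PI / 2 -> 0 < A2 <= PI / 2 -> arg_between w (- A1) A2 -> in_sector A1 A2 w.
Proof.
intros H1 H2 H. destruct (arg_between_sector_functionals w A1 A2 H1 H2 H) as [P [P1 P2]].
now apply sector_functionals_in_sector.
Qed.

(** * Estimates for functions of the class *)

Lemma Cinv_0 : (/ 0)%C = 0%C.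
Proof. unfold Cinv; apply injective_projections; simpl; unfold Rdiv; ring. Qed.

Lemma polar_1_0 : polar 1 0 = 1%C.
Proof. unfold polar. rewrite cos_0, sin_0. apply injective_projections; simpl; ring. Qed.

(** Division by zero returns [0] here, so a zero of [f] would give the quotient the value [0], which
    has no argument in the sense of [is_arg]. *)
Lemma Sstar_neq_0 (a1 a2 : R) (f f' : C -> C) (z : C) :
  Sstar_t a1 a2 f f' -> Cmod z < 1 -> z <> 0%C -> f z <> 0%C.
Proof.
intros [_ [_ [_ H]]] Hz Hz0 E. destruct (H z Hz Hz0) as [t [[N _] _]].
apply N. rewrite E. unfold Cdiv. rewrite Cinv_0. ring.
Qed.

Lemma Sstar_rotation_quotient (a1 a2 : R) (f f' : C -> C) (rho : R) :
  0 < a1 <= 1 -> 0 < a2 <= 1 -> Sstar_t a1 a2 f f' -> 0 < rho < 1 ->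
  exists del, 0 < del /\ forall d z, 0 < d < del -> 0 < Cmod z < rho ->
    in_sector (PI * a1 / 2) (PI * a2 / 2) (log_rotation f z d / (Ci * d))%C /\
    let g := Cpow_R (log_rotation f z d / (Ci * d))%C (/ ((a1 + a2) / 2)) in
    Cmod (g - 1) <= Cmod z / rho * Cmod (g + polar 1 (PI * ((a2 - a1) / (a2 + a1)))).
Proof.
intros H1 H2 HS Hrho. assert (Hpi := PI_RGT_0).
assert (Hnz := fun z => Sstar_neq_0 a1 a2 f f' z HS).
destruct HS as [Hd [Hf0 [Hf0' Harg]]].
assert (Df : forall z, Cmod z < 1 -> cdiff f z (f' z))
  by (intros z Hz; apply cdiff_of_has_cderiv, Hd, Hz).
assert (HC : Ci <> 0%C) by (intros E; injection E; lra).
destruct (cdiff_quotient f 0 (f' 0%C)) as [h [Ch [h0 Hh]]]; [apply Df; rewrite Cmod_0; lra|].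
rewrite Hf0' in h0.
assert (Hh' : forall z : C, z <> 0%C -> f z = (z * h z)%C).
{ intros z Hz. rewrite Hh, Hf0 by exact Hz. replace (z - 0)%C with z by ring. field. exact Hz. }
assert (CN : forall z, Cmod z <= rho -> continuous h z /\ h z <> 0%C).
{ intros z Hz. destruct (Ceq_dec z 0) as [->|N].
  - split; [exact Ch|]. rewrite h0. intros E; injection E; lra.
  - split.
    + apply (continuous_ext_loc _ (fun w => (f w - f 0%C) / (w - 0))%C).
      * generalize (locally_neq z 0 N). apply filter_imp. intros w Hw. symmetry; now apply Hh.
      * apply continuous_Cdiv.
        -- apply continuous_Cminus; [|apply continuous_const].
           apply (cdiff_continuous f z (f' z)), Df. lra.
        -- apply continuous_Cminus; [apply continuous_id|apply continuous_const].
        -- intros E. now apply N, C_minus_eq_0.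
    + intros E. apply (Hnz z); [lra|exact N|]. rewrite Hh', E by exact N. ring. }
destruct (small_rotation_ratio h rho (proj1 Hrho) CN) as [del [Hdel HR]].
(* Below [PI / 2] the principal logarithm of [e^(id)] is [i d], which makes [Q 0 = 1]. *)
exists (Rmin del (PI / 2)). split; [apply Rmin_pos; lra|].
intros d a Hd' Ha.
assert (D1 := Rmin_l del (PI / 2)). assert (D2 := Rmin_r del (PI / 2)).
assert (HCd : (Ci * d)%C <> 0%C)
  by (apply Cmult_neq_0; [exact HC|intros E; apply RtoC_inj in E; lra]).
assert (Hmod : forall (z : C) t, Cmod (z * polar 1 t)%C = Cmod z)
  by (intros z t; rewrite Cmod_mult, Cmod_polar by lra; ring).
assert (Hpol : forall (z : C) t, z <> 0%C -> (z * polar 1 t)%C <> 0%C)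
  by (intros z t Hz; apply Cmod_gt_0; rewrite Hmod; now apply Cmod_gt_0).
assert (Rat : forall (z : C) t, z <> 0%C -> Cmod z <= rho ->
  (polar 1 t * (h (z * polar 1 t) / h z) = f (z * polar 1 t) / f z)%C).
{ intros z t Hz Hzr. rewrite (Hh' z Hz), (Hh' _ (Hpol z t Hz)).
  field. split; [now apply CN|exact Hz]. }
(* Written through [h z = f z / z], the rotation quotient has its correct value at [0] built in. *)
set (Q := fun z => (Clog (polar 1 d * (h (z * polar 1 d) / h z)) / (Ci * d))%C).
assert (Qeq : forall z : C, z <> 0%C -> Cmod z <= rho -> Q z = (log_rotation f z d / (Ci * d))%C).
{ intros z Hz Hzr. unfold Q, log_rotation. now rewrite Cexp_Ci, Rat. }
assert (Qdiff : forall z, 0 < Cmod z < rho -> exists l, cdiff Q z l).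
{ intros z Hz. assert (N : z <> 0%C) by (apply Cmod_gt_0; lra).
  eexists. apply (cdiff_ext_loc (fun w => / (Ci * d) * Clog (f (w * polar 1 d) / f w))%C).
  - assert (HL : locally z (fun w : C => Cmod w < rho))
      by (apply (continuous_Cmod _ _ (continuous_id z) (fun y => y < rho)), open_lt, Hz).
    generalize (filter_and _ _ HL (locally_neq z 0 N)). apply filter_imp. intros w [A B].
    unfold Q. rewrite Rat; [apply Cmult_comm|exact B|now left].
  - apply cdiff_scal. apply (cdiff_comp Clog (fun w => f (w * polar 1 d) / f w)%C).
    + apply cdiff_div.
      * apply (cdiff_comp f (fun w => w * polar 1 d)%C).
        -- apply cdiff_mult; [apply cdiff_id|apply cdiff_const].
        -- apply Df. rewrite Hmod. lra.
      * apply Df. lra.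
      * apply Hnz; [lra|exact N].
    + cbv beta. rewrite <- Rat by (try exact N; lra). apply cdiff_Clog. apply HR; lra. }
assert (A1 : 0 < PI * a1 / 2 <= PI / 2) by (split; nra).
assert (A2 : 0 < PI * a2 / 2 <= PI / 2) by (split; nra).
assert (Fun : forall z k, 0 < Cmod z < rho ->
  (forall w, 0 < Cmod w < rho -> 0 < Re (k * (w * f' w / f w))%C) -> 0 < Re (k * Q z)%C).
{ intros z k Hz Hk. assert (N : z <> 0%C) by (apply Cmod_gt_0; lra).
  rewrite Qeq; [|exact N|lra].
  apply log_rotation_half_plane with f'; [lra|apply Hnz; [lra|exact N]|].
  intros t Ht. split; [apply Df; rewrite Hmod; lra|]. split.
  - rewrite <- Rat by (try exact N; lra). apply HR; lra.
  - apply Hk. rewrite Hmod. exact Hz. }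
assert (Qsec : forall z, 0 < Cmod z < rho -> in_sector (PI * a1 / 2) (PI * a2 / 2) (Q z)).
{ intros z Hz.
  assert (HF : forall w, 0 < Cmod w < rho -> 0 < Re (w * f' w / f w)%C /\
    0 < Re ((sin (PI * a1 / 2), (- cos (PI * a1 / 2))%R) * (w * f' w / f w))%C /\
    0 < Re ((sin (PI * a2 / 2), cos (PI * a2 / 2)) * (w * f' w / f w))%C).
  { intros w Hw. apply arg_between_sector_functionals; trivial.
    replace (- (PI * a1 / 2)) with (- PI * a1 / 2) by field.
    apply Harg; [lra|]. apply Cmod_gt_0; lra. }
  apply sector_functionals_in_sector; trivial.
  - replace (Q z) with (1 * Q z)%C by ring. apply Fun; [exact Hz|].
    intros w Hw. rewrite Cmult_1_l. now apply HF.
  - apply Fun; [exact Hz|]. intros w Hw. now apply HF.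
  - apply Fun; [exact Hz|]. intros w Hw. now apply HF. }
assert (Na : a <> 0%C) by (apply Cmod_gt_0; lra).
rewrite <- Qeq; [|exact Na|lra].
split; [apply Qsec, Ha|].
apply (sector_schwarz Q rho a1 a2 a); try lra; auto.
- unfold Q. rewrite Cmult_0_l, h0.
  replace (polar 1 d * (1 / 1))%C with (Cexp (0, d)).
  + rewrite Clog_Cexp by (simpl; lra).
    replace (0, d) with (Ci * d)%C by (apply injective_projections; simpl; ring).
    field. split; [intros E; apply RtoC_inj in E; lra|exact HC].
  + replace (0, d) with (Ci * d)%C by (apply injective_projections; simpl; ring).
    rewrite Cexp_Ci. field.
- apply continuous_Cdiv; [|apply continuous_const|exact HCd].
  apply continuous_Clog; [|apply HR; [lra|rewrite Cmod_0; lra]].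
  apply continuous_Cmult; [apply continuous_const|].
  apply continuous_Cdiv; [|exact Ch|rewrite h0; intros E; injection E; lra].
  apply (continuous_comp (fun z => z * polar 1 d)%C h).
  + apply continuous_Cmult; [apply continuous_id|apply continuous_const].
  + rewrite Cmult_0_l. exact Ch.
Qed.

Lemma Sstar_subordination (a1 a2 : R) (f f' : C -> C) (z : C) :
  0 < a1 <= 1 -> 0 < a2 <= 1 -> Sstar_t a1 a2 f f' -> 0 < Cmod z < 1 ->
  let g := Cpow_R (z * f' z / f z)%C (/ ((a1 + a2) / 2)) in
  Cmod (g - 1) <= Cmod z * Cmod (g + polar 1 (PI * ((a2 - a1) / (a2 + a1)))).
Proof.
intros H1 H2 HS Hz.
set (k := polar 1 (PI * ((a2 - a1) / (a2 + a1)))). set (b := / ((a1 + a2) / 2)). intros g.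
assert (Hpi := PI_RGT_0).
assert (N : z <> 0%C) by (apply Cmod_gt_0; lra).
assert (HC : Ci <> 0%C) by (intros E; injection E; lra).
assert (Nf : f z <> 0%C) by (apply (Sstar_neq_0 a1 a2 f f' z HS); [lra|exact N]).
assert (Hsec : in_sector (PI * a1 / 2) (PI * a2 / 2) (z * f' z / f z)%C).
{ apply arg_between_in_sector; try (split; nra).
  replace (- (PI * a1 / 2)) with (- PI * a1 / 2) by field. apply HS; [lra|exact N]. }
(* The limit [d -> 0]: with [h] the slope of [log_rotation f z] at [0], the quotient at [d] is
   [h d / Ci], continuous down to [d = 0], where it equals [z f' / f]. A failure of the inequality
   there would persist for small [d > 0]. *)
assert (Step : forall rho, Cmod z < rho < 1 -> Cmod (g - 1) <= Cmod z / rho * Cmod (g + k)).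
{ intros rho Hrho. apply Rnot_lt_le. intros Hlt.
  destruct (Sstar_rotation_quotient a1 a2 f f' rho H1 H2 HS ltac:(lra)) as [del [Hdel HQ]].
  assert (Dl : cdiff (log_rotation f z) (RtoC 0) (Ci * (z * f' z / f z))%C).
  { destruct HS as [Hd _]. eapply cdiff_eq.
    - apply cdiff_log_rotation; rewrite ?polar_1_0, ?Cmult_1_r; [|exact Nf|].
      + apply cdiff_of_has_cderiv, Hd; lra.
      + replace (f z / f z)%C with (RtoC 1) by (field; exact Nf). simpl; lra.
    - rewrite polar_1_0, Cmult_1_r. reflexivity. }
  assert (L0 : log_rotation f z (RtoC 0) = 0%C).
  { unfold log_rotation. rewrite Cexp_Ci, polar_1_0, Cmult_1_r.
    replace (f z / f z)%C with (RtoC 1) by (field; exact Nf).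
    rewrite <- Cexp_0, Clog_Cexp; [reflexivity|]. simpl; lra. }
  destruct Dl as [h [Ch [Hh He]]].
  set (Psi := fun w => Cmod (Cpow_R (h w / Ci) b - 1) - Cmod z / rho * Cmod (Cpow_R (h w / Ci) b + k)).
  assert (E0 : (h (RtoC 0) / Ci)%C = (z * f' z / f z)%C).
  { rewrite Hh. field. split; assumption. }
  assert (CPsi : continuous Psi (RtoC 0)).
  { assert (CP : continuous (fun w => Cpow_R (h w / Ci) b) (RtoC 0)).
    { apply continuous_Cpow_R; [|rewrite E0; apply Hsec].
      apply continuous_Cdiv; [exact Ch|apply continuous_const|exact HC]. }
    apply continuous_Rminus; [|apply continuous_Rmult; [apply continuous_const|]];
      apply continuous_Cmod.
    - apply continuous_Cminus; [exact CP|apply continuous_const].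
    - apply continuous_Cplus; [exact CP|apply continuous_const]. }
  assert (HP : 0 < Psi (RtoC 0)) by (unfold Psi; rewrite E0; fold g; lra).
  assert (LP : locally (RtoC 0) (fun w => 0 < Psi w))
    by (apply (CPsi (fun y => 0 < y)), open_gt, HP).
  generalize (filter_and _ _ He LP). intros HH.
  apply locally_C_Cmod in HH. destruct HH as [e [He0 HH]].
  set (d := Rmin (e / 2) (del / 2)).
  assert (Hd0 : 0 < d) by (apply Rmin_pos; lra).
  assert (Hd1 : d <= e / 2) by apply Rmin_l. assert (Hd2 : d <= del / 2) by apply Rmin_r.
  destruct (HH (RtoC d)) as [A B].
  { rewrite <- RtoC_minus, Cmod_R, Rminus_0_r, Rabs_pos_eq; lra. }
  destruct (HQ d z ltac:(lra) ltac:(lra)) as [_ I].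
  rewrite A, L0 in I.
  replace ((0 + (d - 0) * h d) / (Ci * d))%C with (h d / Ci)%C in I
    by (field; split; [intros E; apply RtoC_inj in E; lra|exact HC]).
  unfold Psi in B. fold k b in I. cbv zeta in I. lra. }
apply Rnot_lt_le. intros Hlt.
assert (X := Cmod_ge_0 (g - 1)%C). assert (Y := Cmod_ge_0 (g + k)%C).
set (x := Cmod (g - 1)%C) in *. set (y := Cmod (g + k)%C) in *.
assert (Hx : 0 < x) by nra.
assert (Hxy : Cmod z * y / x < 1) by (apply Rlt_div_l; lra).
(* The limit [rho -> 1]: a failure means [Cmod z * y / x < 1], so some [rho < 1] exceeds both this
   number and [Cmod z], against [Step]. *)
set (m := Rmax (Cmod z) (Cmod z * y / x)).
assert (M1 : Cmod z <= m) by apply Rmax_l. assert (M2 : Cmod z * y / x <= m) by apply Rmax_r.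
assert (M3 : m < 1) by (apply Rmax_lub_lt; lra).
assert (S := Step ((m + 1) / 2) ltac:(lra)).
assert (T : x * ((m + 1) / 2) <= Cmod z * y).
{ apply Rle_div_r; [lra|]. eapply Rle_trans; [exact S|]. right; field. lra. }
apply Rle_div_l in M2; [|exact Hx]. nra.
Qed.

(** * The two bounds *)

(** The difference of the two sides vanishes at [0] and has derivative [b * (tan x - tan (b * x))],
    nonnegative on [[0, PI / 2)]; evenness covers negative [s]. *)
Lemma ln_cos_scale (b s : R) :
  0 < b <= 1 -> - (PI / 2) < s < PI / 2 -> b * ln (cos s) <= ln (cos (b * s)).
Proof.
assert (H : forall s, 0 < b <= 1 -> 0 <= s < PI / 2 -> b * ln (cos s) <= ln (cos (b * s))).
{ clear s. intros s Hb Hs. assert (Hpi := PI_RGT_0).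
  assert (Hin : forall x, 0 <= x <= s -> 0 < cos x /\ 0 < cos (b * x))
    by (intros x Hx; split; apply cos_gt_0; nra).
  assert (HD : forall x, 0 <= x <= s -> is_derive (fun x => ln (cos (b * x)) - b * ln (cos x)) x
    (b * (tan x - tan (b * x)))).
  { intros x Hx. destruct (Hin x Hx) as [A B].
    auto_derive; [repeat split; trivial|]. unfold tan. field. split; lra. }
  destruct (MVT_gen (fun x => ln (cos (b * x)) - b * ln (cos x)) 0 s
    (fun x => b * (tan x - tan (b * x)))) as [c [Hc E]].
  - intros x Hx. rewrite Rmin_left, Rmax_right in Hx by lra. apply HD; lra.
  - intros x Hx. rewrite Rmin_left, Rmax_right in Hx by lra.
    apply derivable_continuous_pt. eexists. apply is_derive_Reals. now apply HD.
  - rewrite Rmin_left, Rmax_right in Hc by lra.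
    rewrite Rmult_0_r, cos_0, ln_1, Rmult_0_r, !Rminus_0_r in E.
    assert (T : tan (b * c) <= tan c).
    { destruct (Req_dec (b * c) c) as [->|N]; [lra|]. left. apply tan_increasing; nra. }
    assert (0 <= b * (tan c - tan (b * c))) by (apply Rmult_le_pos; lra).
    nra. }
intros Hb Hs. destruct (Rle_dec 0 s) as [P|P]; [apply H; lra|].
rewrite <- (cos_neg s), <- (cos_neg (b * s)).
replace (- (b * s)) with (b * - s) by ring. apply H; lra.
Qed.

Lemma Cmod_1_plus_polar (t : R) : - PI <= t <= PI -> Cmod (1 + polar 1 t) = 2 * cos (t / 2).
Proof.
intros Ht. assert (H : 0 <= cos (t / 2)) by (apply cos_ge_0; lra).
rewrite <- (sqrt_pow2 (2 * cos (t / 2))) by lra.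
unfold Cmod. f_equal. unfold polar; simpl fst; simpl snd.
replace t with (2 * (t / 2)) at 1 2 by field. rewrite cos_2a, sin_2a.
assert (E := sin2_cos2 (t / 2)). unfold Rsqr in E.
revert E. generalize (sin (t / 2)) (cos (t / 2)). intros x y E.
replace (x * x) with (1 - y * y) by lra.
replace ((1 + 1 * (y * y - (1 - y * y))) ^ 2 + (0 + 1 * (2 * x * y)) ^ 2)
  with (4 * y ^ 2 * (x * x + y * y)) by (replace (x * x) with (1 - y * y) by lra;
    replace ((0 + 1 * (2 * x * y)) ^ 2) with (4 * (x * x) * (y * y)) by ring;
    replace (x * x) with (1 - y * y) by lra; ring).
rewrite E; ring.
Qed.

(** The argument yields [cos (PI * th / 2)]; here it is relaxed to the [cos (th / 2)] of the
    theorem. *)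
Lemma cos_half_pi_le (th : R) : -1 <= th <= 1 -> cos (PI * th / 2) <= cos (th / 2).
Proof.
assert (Hpi := PI2_1).
assert (H : forall x, 0 <= x <= 1 -> cos (PI * x / 2) <= cos (x / 2)).
{ intros x Hx. apply cos_decr_1; nra. }
intros Ht. destruct (Rle_dec 0 th) as [P|P]; [apply H; lra|].
rewrite <- (cos_neg (PI * th / 2)), <- (cos_neg (th / 2)).
replace (- (PI * th / 2)) with (PI * (- th) / 2) by field.
replace (- (th / 2)) with ((- th) / 2) by field. apply H; lra.
Qed.

Lemma Re_le_Rpower (w : C) (b U : R) :
  0 < b -> 0 < Re w -> Cmod (Cpow_R w (/ b)) <= U -> Re w <= Rpower U b.
Proof.
intros Hb Hw HU.
unfold Cpow_R in HU. rewrite Cmod_Cexp in HU.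
replace (Re (RtoC (/ b) * Clog w)%C) with (/ b * ln (Cmod w)) in HU by (unfold Re; simpl; ring).
assert (Hm := proj1 (Cmod_gt_0 w) (Re_pos_neq_0 w Hw)).
apply Rle_trans with (Cmod w); [eapply Rle_trans; [apply Rle_abs|apply re_le_Cmod]|].
apply Rle_trans with (Rpower (exp (/ b * ln (Cmod w))) b).
- unfold Rpower. rewrite ln_exp. replace (b * (/ b * ln (Cmod w))) with (ln (Cmod w)) by (field; lra).
  rewrite exp_ln; lra.
- apply Rle_Rpower_l; [lra|]. split; [apply exp_pos|exact HU].
Qed.

(** For [w] of argument [b * s], [Re w = Cmod w * cos (b * s) >= Cmod w * (cos s)^b], and the right
    side is the [b]-th power of the real part of [w^(1/b)]. *)
Lemma Rpower_le_Re (w : C) (b L : R) :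
  0 < b <= 1 -> 0 < Re w -> - PI < / b * Im (Clog w) < PI ->
  0 < L <= Re (Cpow_R w (/ b)) -> Rpower L b <= Re w.
Proof.
intros Hb Hw Ht HL. assert (Hpi := PI_RGT_0).
assert (Hm := proj1 (Cmod_gt_0 w) (Re_pos_neq_0 w Hw)).
assert (E := Clog_polar w Hw).
set (s := / b * Im (Clog w)) in *.
assert (Es : Im (Clog w) = b * s) by (unfold s; field; lra).
assert (Eg : Re (Cpow_R w (/ b)) = exp (/ b * ln (Cmod w)) * cos s).
{ unfold Cpow_R, Cexp, s. unfold Re, Im; simpl. f_equal; f_equal; ring. }
rewrite Eg in HL.
assert (Hexp := exp_pos (/ b * ln (Cmod w))).
assert (Hcos : 0 < cos s) by nra.
(* A tilted half-plane admits [s] beyond [PI / 2], but the positive lower bound [L] forces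
   [cos s > 0]. *)
assert (Hs : - (PI / 2) < s < PI / 2).
{ split; apply Rnot_le_lt; intros Hle.
  - assert (0 <= cos (s + PI)) by (apply cos_ge_0; lra). rewrite neg_cos in H. lra.
  - assert (0 <= cos (s - PI)) by (apply cos_ge_0; lra).
    rewrite cos_minus, cos_PI, sin_PI in H. lra. }
apply Rle_trans with (Rpower (exp (/ b * ln (Cmod w)) * cos s) b);
  [apply Rle_Rpower_l; lra|].
assert (ER : Re w = exp (ln (Cmod w) + ln (cos (b * s)))).
{ rewrite exp_plus, !exp_ln; [|apply cos_gt_0; nra|exact Hm].
  rewrite E at 1. rewrite Es. unfold Re; simpl. ring. }
rewrite ER. unfold Rpower. rewrite ln_mult, ln_exp by assumption.
assert (C := ln_cos_scale b s Hb Hs).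
replace (b * (/ b * ln (Cmod w) + ln (cos s))) with (ln (Cmod w) + b * ln (cos s)) by (field; lra).
destruct (Req_dec (b * ln (cos s)) (ln (cos (b * s)))) as [->|N]; [lra|].
left. apply exp_increasing. lra.
Qed.

Theorem theorem2p1 (a1 a2 : R) (f f' : C -> C) :
  0 < a1 <= 1 -> 0 < a2 <= 1 ->
  Sstar_t a1 a2 f f' ->
  let theta := (a2 - a1) / (a2 + a1) in
  let c := cos (theta / 2) in
  (forall z : C, z <> 0%C -> Cmod z <= 1 / (2 * c + 1) ->
     rpow ((1 - (2 * c + 1) * Cmod z) / (1 - Cmod z)) ((a1 + a2) / 2)
       <= Re (z * f' z / f z)%C) /\
  (forall z : C, z <> 0%C -> Cmod z < 1 ->
     0 < Re (z * f' z / f z)%C /\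
     Re (z * f' z / f z)%C
       <= rpow ((1 + (2 * c - 1) * Cmod z) / (1 - Cmod z)) ((a1 + a2) / 2)).
Proof.
intros H1 H2 HS theta c. assert (Hpi := PI_RGT_0). assert (Hpi2 := PI2_1).
assert (Hth : -1 < theta < 1) by (unfold theta; split; [apply Rlt_div_r|apply Rlt_div_l]; lra).
assert (Hc : 0 < c) by (apply cos_gt_0; lra).
assert (Hsec : forall z : C, z <> 0%C -> Cmod z < 1 ->
  in_sector (PI * a1 / 2) (PI * a2 / 2) (z * f' z / f z)%C).
{ intros z N Hz. apply arg_between_in_sector; try (split; nra).
  replace (- (PI * a1 / 2)) with (- PI * a1 / 2) by field. apply HS; assumption. }
assert (Hkey : forall z : C, z <> 0%C -> Cmod z < 1 ->
  Cmod (Cpow_R (z * f' z / f z)%C (/ ((a1 + a2) / 2)) - 1) <= 2 * c * Cmod z / (1 - Cmod z)).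
{ intros z N Hz. assert (Hz0 := proj1 (Cmod_gt_0 z) N).
  assert (S := Sstar_subordination a1 a2 f f' z H1 H2 HS ltac:(lra)). cbv zeta in S.
  fold theta in S. set (g := Cpow_R _ _) in *.
  (* Inserted in [Cmod (g - 1) <= r * Cmod (g + polar 1 (PI * theta))], this is solved for
     [Cmod (g - 1)]. *)
  assert (T : Cmod (g + polar 1 (PI * theta)) <= Cmod (g - 1) + 2 * c).
  { replace (g + polar 1 (PI * theta))%C with ((g - 1) + (1 + polar 1 (PI * theta)))%C by ring.
    eapply Rle_trans; [apply Cmod_triangle|]. apply Rplus_le_compat_l.
    rewrite Cmod_1_plus_polar by (split; nra).
    apply Rmult_le_compat_l; [lra|]. apply cos_half_pi_le; lra. }
  apply Rle_div_r; [lra|]. nra. }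
split.
- intros z N Hz. assert (Hz0 := proj1 (Cmod_gt_0 z) N).
  assert (Hz' : Cmod z * (2 * c + 1) <= 1) by (apply Rle_div_r; lra).
  assert (Hz1 : Cmod z < 1) by nra.
  destruct (Hsec z N Hz1) as [HR Ht]. assert (K := Hkey z N Hz1).
  (* At the extreme radius [1 / (2 * c + 1)] the base is [0], and the bound reduces to positivity of
     the real part. *)
  unfold rpow. destruct (Req_EM_T _ 0) as [_|NZ]; [lra|].
  set (L := (1 - (2 * c + 1) * Cmod z) / (1 - Cmod z)) in *.
  assert (HL0 : 0 <= L) by (apply Rle_div_r; lra).
  assert (HL : L = 1 - 2 * c * Cmod z / (1 - Cmod z)) by (unfold L; field; lra).
  apply Rpower_le_Re; [lra|exact HR| |].
  + assert (Hb : 0 < / ((a1 + a2) / 2)) by (apply Rinv_0_lt_compat; lra).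
    assert (B1 : / ((a1 + a2) / 2) * (PI * a2 / 2) < PI).
    { replace (/ ((a1 + a2) / 2) * (PI * a2 / 2)) with (PI * a2 / (a1 + a2)) by (field; lra).
      apply Rlt_div_l; nra. }
    assert (B2 : / ((a1 + a2) / 2) * (PI * a1 / 2) < PI).
    { replace (/ ((a1 + a2) / 2) * (PI * a1 / 2)) with (PI * a1 / (a1 + a2)) by (field; lra).
      apply Rlt_div_l; nra. }
    split; nra.
  + split; [lra|]. rewrite HL. set (g := Cpow_R _ _) in *.
    assert (A := re_le_Cmod (g - 1)%C). apply Rabs_le_between in A.
    replace (Re (g - 1)%C) with (Re g - 1) in A by (unfold Re; simpl; ring). lra.
- intros z N Hz. destruct (Hsec z N Hz) as [HR _]. assert (K := Hkey z N Hz).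
  split; [exact HR|].
  set (g := Cpow_R _ _) in *.
  set (U := (1 + (2 * c - 1) * Cmod z) / (1 - Cmod z)) in *.
  assert (HU : U = 1 + 2 * c * Cmod z / (1 - Cmod z)) by (unfold U; field; lra).
  assert (HgU : Cmod g <= U).
  { rewrite HU. replace g with ((g - 1) + 1)%C by ring.
    eapply Rle_trans; [apply Cmod_triangle|]. rewrite Cmod_1. lra. }
  unfold rpow. destruct (Req_EM_T U 0) as [EU|_].
  + assert (P : 0 < Cmod g) by (unfold g, Cpow_R; rewrite Cmod_Cexp; apply exp_pos). lra.
  + apply Re_le_Rpower; [lra|exact HR|exact HgU].
Qed.
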